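(* Let $\Bbbk$ be an algebraically closed field, let $\mathcal{C}$ be a fusion category over $\Bbbk$, and let $G$ be a finite group acting on $\mathcal{C}$ by tensor autoequivalences. Assume that the characteristic of $\Bbbk$ does not divide the order $|G|$ of $G$, so that the equivariantization $\mathcal{C}^G$ is a fusion category. Let $H$ be a subgroup of $G$. Then the restriction functor $r^G_H:\mathcal{C}^G\to\mathcal{C}^H$ is normal if and only if $H$ is a normal subgroup of $G$. Moreover, in that case the group $G/H$ acts on $\mathcal{C}^H$ by tensor autoequivalences, and $\mathcal{C}^G$ is tensor equivalent to $(\mathcal{C}^H)^{G/H}$ in such a way that the triangle of tensor functors commutes: there is a tensor equivalence $K:\mathcal{C}^G\to(\mathcal{C}^H)^{G/H}$ with $U_{G/H}\circ K=r^G_H$, where $U_{G/H}:(\mathcal{C}^H)^{G/H}\to\mathcal{C}^H$ is the forgetful functor.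
   Context: A fusion category over a field $\Bbbk$ is a $\Bbbk$-linear semisimple rigid monoidal category with finitely many isomorphism classes of simple objects, finite dimensional Hom spaces, such that $\mathrm{End}(S)=\Bbbk$ for every simple object $S$, and whose unit object $\mathbf{1}$ is simple. A tensor functor is a strong monoidal $\Bbbk$-linear functor. A tensor functor $F:\mathcal{X}\to\mathcal{Y}$ between fusion categories is normal if for every simple object $X$ of $\mathcal{X}$ such that $F(X)$ contains $\mathbf{1}$ as a direct summand, $F(X)$ is isomorphic to $\mathbf{1}^n$ for some $n\in\mathbb{N}$. An action of a finite group $G$ on $\mathcal{C}$ by tensor autoequivalences is a strong monoidal functor $\rho:G\to\mathrm{Aut}_\otimes(\mathcal{C})$, where $G$ is viewed as a discrete monoidal category and $\mathrm{Aut}_\otimes(\mathcal{C})$ is the monoidal category of tensor autoequivalences of $\mathcal{C}$. The equivariantization $\mathcal{C}^G$ has as objects the pairs $(X,(r_g)_{g\in G})$, with $X$ an object of $\mathcal{C}$ and $r_g:\rho(g)(X)\to X$ isomorphisms compatible with the monoidal structure of $\rho$ (i.e. $r_g\circ\rho(g)(r_h)$ corresponds to $r_{gh}$ under $\rho(g)\rho(h)\simeq\rho(gh)$, and $r_1$ corresponds to $\mathrm{id}_X$ under $\rho(1)\simeq\mathrm{id}$); morphisms are the morphisms of $\mathcal{C}$ commuting with the $r_g$'s, and the tensor product is induced by that of $\mathcal{C}$. The forgetful functor $U_G:\mathcal{C}^G\to\mathcal{C}$, $(X,(r_g)_{g\in G})\mapsto X$, is a tensor functor. For a subgroup $H\subset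 G$, acting on $\mathcal{C}$ by restriction of $\rho$, the restriction functor $r^G_H:\mathcal{C}^G\to\mathcal{C}^H$ sends $(X,(r_g)_{g\in G})$ to $(X,(r_h)_{h\in H})$. *)

(* Defs.v *)
(* boolp: functional extensionality and proof irrelevance are needed for the
   category of monoidal natural transformations. *)
From HB Require Import structures.
From mathcomp Require Import all_boot all_algebra all_fingroup boolp.

Set Implicit Arguments.
Unset Strict Implicit.
Unset Printing Implicit Defensive.

Import GRing.Theory.
Local Open Scope ring_scope.

Obligation Tactic := idtac.

Declare Scope cat_scope.
Delimit Scope cat_scope with cat.
Local Open Scope cat_scope.

Reserved Notation "g ∘ f" (at level 40, left associativity).
Reserved Notation "X ⊗ Y" (at level 35, right associativity).
Reserved Notation "f ⊠ g" (at level 35, right associativity).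

Record category_structure (ob : Type) (Hom : ob -> ob -> Type) :=
  CategoryStructure {
  cs_id : forall X, Hom X X;
  cs_comp : forall X Y Z, Hom Y Z -> Hom X Y -> Hom X Z;
  cs_comp1f : forall X Y (f : Hom X Y), cs_comp (cs_id Y) f = f;
  cs_compf1 : forall X Y (f : Hom X Y), cs_comp f (cs_id X) = f;
  cs_compA : forall X Y Z W (h : Hom Z W) (g : Hom Y Z) (f : Hom X Y),
    cs_comp h (cs_comp g f) = cs_comp (cs_comp h g) f }.

Record category := Category {
  ob :> Type;
  Hom : ob -> ob -> Type;
  cat_structure : category_structure Hom }.

Arguments Hom {c} X Y.

Definition mid {C : category} (X : C) : Hom X X := cs_id (cat_structure C) X.
Definition mcomp {C : category} {X Y Z : C} (g : Hom Y Z) (f : Hom X Y) :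
  Hom X Z := cs_comp (cat_structure C) g f.
Notation "g ∘ f" := (mcomp g f) : cat_scope.

Section CategoryTheory.
Variable C : category.
Lemma mcomp1f (X Y : C) (f : Hom X Y) : mid Y ∘ f = f.
Proof. exact: cs_comp1f. Qed.
Lemma mcompf1 (X Y : C) (f : Hom X Y) : f ∘ mid X = f.
Proof. exact: cs_compf1. Qed.
Lemma mcompA (X Y Z W : C) (h : Hom Z W) (g : Hom Y Z) (f : Hom X Y) :
  h ∘ (g ∘ f) = (h ∘ g) ∘ f.
Proof. exact: cs_compA. Qed.
End CategoryTheory.

Record iso (C : category) (X Y : C) := Iso {
  iso_hom :> Hom X Y;
  iso_inv : Hom Y X;
  iso_homK : iso_inv ∘ iso_hom = mid X;
  iso_invK : iso_hom ∘ iso_inv = mid Y }.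

Definition isomorphic (C : category) (X Y : C) : Prop := inhabited (iso X Y).

Definition is_isomorphism (C : category) (X Y : C) (f : Hom X Y) : Prop :=
  exists i : iso X Y, iso_hom i = f.

Definition is_mono (C : category) (X Y : C) (f : Hom X Y) : Prop :=
  forall (W : C) (u v : Hom W X), f ∘ u = f ∘ v -> u = v.

Definition is_epi (C : category) (X Y : C) (f : Hom X Y) : Prop :=
  forall (W : C) (u v : Hom Y W), u ∘ f = v ∘ f -> u = v.

Section IsoTheory.
Variable C : category.

Lemma iso_eq (X Y : C) (i j : iso X Y) : iso_hom i = iso_hom j -> i = j.
Proof.
case: i j => [f f' ff' f'f] [g g' gg' g'g] /= fg; subst g.
have f'E : f' = g' by rewrite -[f']mcompf1 -g'g mcompA ff' mcomp1f.
by subst g'; congr Iso; exact: Prop_irrelevance.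
Qed.

Definition iso_id (X : C) : iso X X :=
  Iso (mcomp1f (mid X)) (mcomp1f (mid X)).

Definition iso_sym (X Y : C) (i : iso X Y) : iso Y X :=
  Iso (iso_invK i) (iso_homK i).

Program Definition iso_comp (X Y Z : C) (j : iso Y Z) (i : iso X Y) :
  iso X Z := @Iso C X Z (j ∘ i) (iso_inv i ∘ iso_inv j) _ _.
Next Obligation.
move=> X Y Z j i.
by rewrite -mcompA (mcompA (iso_inv j)) iso_homK mcomp1f iso_homK.
Qed.
Next Obligation.
move=> X Y Z j i.
by rewrite -mcompA (mcompA i) iso_invK mcomp1f iso_invK.
Qed.

Lemma iso_cancel_r (X Y Z : C) (i : iso X Y) (f g : Hom Y Z) :
  f ∘ i = g ∘ i -> f = g.
Proof.
move=> e; rewrite -[f]mcompf1 -[g]mcompf1 -(iso_invK i).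
by rewrite !mcompA e.
Qed.

Lemma iso_cancel_l (X Y Z : C) (i : iso Y Z) (f g : Hom X Y) :
  i ∘ f = i ∘ g -> f = g.
Proof.
move=> e; rewrite -[f]mcomp1f -[g]mcomp1f -(iso_homK i).
by rewrite -!mcompA e.
Qed.

End IsoTheory.

Record functor (C D : category) := Functor {
  fun_ob :> C -> D;
  fun_hom : forall X Y : C, Hom X Y -> Hom (fun_ob X) (fun_ob Y);
  fun_id : forall X : C, fun_hom (mid X) = mid (fun_ob X);
  fun_comp : forall (X Y Z : C) (g : Hom Y Z) (f : Hom X Y),
    fun_hom (g ∘ f) = fun_hom g ∘ fun_hom f }.

Arguments fun_hom {C D} f {X Y} : rename.

Program Definition functor_id (C : category) : functor C C :=
  @Functor C C (fun X => X) (fun X Y f => f) _ _.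
Solve All Obligations with by [].

Program Definition functor_comp (C D E : category)
    (G : functor D E) (F : functor C D) : functor C E :=
  @Functor C E (fun X => G (F X)) (fun X Y f => fun_hom G (fun_hom F f)) _ _.
Next Obligation. by move=> C D E G F X /=; rewrite !fun_id. Qed.
Next Obligation. by move=> C D E G F X Y Z g f /=; rewrite !fun_comp. Qed.

Program Definition fun_iso (C D : category) (F : functor C D) (X Y : C)
    (i : iso X Y) : iso (F X) (F Y) :=
  @Iso D (F X) (F Y) (fun_hom F i) (fun_hom F (iso_inv i)) _ _.
Next Obligation. by move=> *; rewrite -fun_comp iso_homK fun_id. Qed.
Next Obligation. by move=> *; rewrite -fun_comp iso_invK fun_id. Qed.

Record nat_trans (C D : category) (F G : functor C D) := NatTrans {
  nt_app :> forall X : C, Hom (F X) (G X);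
  nt_nat : forall (X Y : C) (f : Hom X Y),
    nt_app Y ∘ fun_hom F f = fun_hom G f ∘ nt_app X }.

Definition naturally_isomorphic (C D : category) (F G : functor C D) : Prop :=
  exists a : nat_trans F G, forall X : C, is_isomorphism (a X).

Definition is_equivalence (C D : category) (F : functor C D) : Prop :=
  exists G : functor D C,
    naturally_isomorphic (functor_comp G F) (functor_id C) /\
    naturally_isomorphic (functor_comp F G) (functor_id D).

Record monoidal_structure (C : category) := MonoidalStructure {
  ms_tens : C -> C -> C;
  ms_thom : forall X X' Y Y' : C,
    Hom X X' -> Hom Y Y' -> Hom (ms_tens X Y) (ms_tens X' Y');
  ms_unit : C;
  ms_assoc : forall X Y Z : C,
    iso (ms_tens (ms_tens X Y) Z) (ms_tens X (ms_tens Y Z));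
  ms_lunit : forall X : C, iso (ms_tens ms_unit X) X;
  ms_runit : forall X : C, iso (ms_tens X ms_unit) X;
  ms_thom_id : forall X Y : C,
    ms_thom (mid X) (mid Y) = mid (ms_tens X Y);
  ms_thom_comp : forall (X X' X'' Y Y' Y'' : C)
      (f' : Hom X' X'') (f : Hom X X') (g' : Hom Y' Y'') (g : Hom Y Y'),
    ms_thom (f' ∘ f) (g' ∘ g) = ms_thom f' g' ∘ ms_thom f g;
  ms_assoc_nat : forall (X X' Y Y' Z Z' : C)
      (f : Hom X X') (g : Hom Y Y') (h : Hom Z Z'),
    ms_assoc X' Y' Z' ∘ ms_thom (ms_thom f g) h =
    ms_thom f (ms_thom g h) ∘ ms_assoc X Y Z;
  ms_lunit_nat : forall (X X' : C) (f : Hom X X'),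
    ms_lunit X' ∘ ms_thom (mid ms_unit) f = f ∘ ms_lunit X;
  ms_runit_nat : forall (X X' : C) (f : Hom X X'),
    ms_runit X' ∘ ms_thom f (mid ms_unit) = f ∘ ms_runit X;
  ms_triangle : forall X Y : C,
    ms_thom (mid X) (ms_lunit Y) ∘ ms_assoc X ms_unit Y =
    ms_thom (ms_runit X) (mid Y);
  ms_pentagon : forall X Y Z W : C,
    ms_assoc X Y (ms_tens Z W) ∘ ms_assoc (ms_tens X Y) Z W =
    ms_thom (mid X) (ms_assoc Y Z W) ∘
      ms_assoc X (ms_tens Y Z) W ∘ ms_thom (ms_assoc X Y Z) (mid W) }.

Record moncat := MonCat {
  mc_cat :> category;
  mc_structure : monoidal_structure mc_cat }.

Section MonCatOps.
Variable C : moncat.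
Definition tens (X Y : C) : C := ms_tens (mc_structure C) X Y.
Definition thom (X X' Y Y' : C) (f : Hom X X') (g : Hom Y Y') :
  Hom (tens X Y) (tens X' Y') := ms_thom (mc_structure C) f g.
Definition munit : C := ms_unit (mc_structure C).
Definition assoc (X Y Z : C) :
  iso (tens (tens X Y) Z) (tens X (tens Y Z)) := ms_assoc (mc_structure C) X Y Z.
Definition lunit (X : C) : iso (tens munit X) X := ms_lunit (mc_structure C) X.
Definition runit (X : C) : iso (tens X munit) X := ms_runit (mc_structure C) X.
End MonCatOps.

Arguments munit {C}.

Notation "X ⊗ Y" := (tens X Y) : cat_scope.
Notation "f ⊠ g" := (thom f g) : cat_scope.

Section MonCatTheory.
Variable C : moncat.
Lemma thom_id (X Y : C) : mid X ⊠ mid Y = mid (X ⊗ Y).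
Proof. exact: ms_thom_id. Qed.
Lemma thom_comp (X X' X'' Y Y' Y'' : C)
    (f' : Hom X' X'') (f : Hom X X') (g' : Hom Y' Y'') (g : Hom Y Y') :
  (f' ∘ f) ⊠ (g' ∘ g) = (f' ⊠ g') ∘ (f ⊠ g).
Proof. exact: ms_thom_comp. Qed.
Lemma assoc_nat (X X' Y Y' Z Z' : C)
    (f : Hom X X') (g : Hom Y Y') (h : Hom Z Z') :
  assoc X' Y' Z' ∘ ((f ⊠ g) ⊠ h) = (f ⊠ (g ⊠ h)) ∘ assoc X Y Z.
Proof. exact: ms_assoc_nat. Qed.
Lemma lunit_nat (X X' : C) (f : Hom X X') :
  lunit X' ∘ (mid munit ⊠ f) = f ∘ lunit X.
Proof. exact: ms_lunit_nat. Qed.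
Lemma runit_nat (X X' : C) (f : Hom X X') :
  runit X' ∘ (f ⊠ mid munit) = f ∘ runit X.
Proof. exact: ms_runit_nat. Qed.
Lemma triangle (X Y : C) :
  (mid X ⊠ lunit Y) ∘ assoc X munit Y = runit X ⊠ mid Y.
Proof. exact: ms_triangle. Qed.
Lemma pentagon (X Y Z W : C) :
  assoc X Y (Z ⊗ W) ∘ assoc (X ⊗ Y) Z W =
  (mid X ⊠ assoc Y Z W) ∘ assoc X (Y ⊗ Z) W ∘ (assoc X Y Z ⊠ mid W).
Proof. exact: ms_pentagon. Qed.

Program Definition thom_iso (X X' Y Y' : C) (i : iso X X') (j : iso Y Y') :
    iso (X ⊗ Y) (X' ⊗ Y') :=
  @Iso C (X ⊗ Y) (X' ⊗ Y') (i ⊠ j) (iso_inv i ⊠ iso_inv j) _ _.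
Next Obligation. by move=> *; rewrite -thom_comp !iso_homK thom_id. Qed.
Next Obligation. by move=> *; rewrite -thom_comp !iso_invK thom_id. Qed.

End MonCatTheory.

(* X' is a left dual of X: both zigzag identities, with the associativity and
   unit constraints written out. *)
Definition is_dual (C : moncat) (X' X : C) : Prop :=
  exists (ev : Hom (X' ⊗ X) munit) (coev : Hom munit (X ⊗ X')),
    runit X ∘ (mid X ⊠ ev) ∘ assoc X X' X ∘ (coev ⊠ mid X) = lunit X
    /\ lunit X' ∘ (ev ⊠ mid X') ∘ iso_inv (assoc X' X X') ∘
         (mid X' ⊠ coev) = runit X'.

Definition is_rigid (C : moncat) : Prop :=
  forall X : C, (exists X' : C, is_dual X' X) /\ (exists X' : C, is_dual X X').

Record mon_functor (C D : moncat) := MonFunctor {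
  mf_fun :> functor C D;
  mf_mu : forall X Y : C, iso (mf_fun X ⊗ mf_fun Y) (mf_fun (X ⊗ Y));
  mf_eps : iso munit (mf_fun munit);
  mf_mu_nat : forall (X X' Y Y' : C) (f : Hom X X') (g : Hom Y Y'),
    mf_mu X' Y' ∘ (fun_hom mf_fun f ⊠ fun_hom mf_fun g) =
    fun_hom mf_fun (f ⊠ g) ∘ mf_mu X Y;
  mf_assoc : forall X Y Z : C,
    fun_hom mf_fun (assoc X Y Z) ∘ mf_mu (X ⊗ Y) Z ∘
      (mf_mu X Y ⊠ mid (mf_fun Z)) =
    mf_mu X (Y ⊗ Z) ∘ (mid (mf_fun X) ⊠ mf_mu Y Z) ∘
      assoc (mf_fun X) (mf_fun Y) (mf_fun Z);
  mf_lunit : forall X : C,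
    fun_hom mf_fun (lunit X) ∘ mf_mu munit X ∘ (mf_eps ⊠ mid (mf_fun X)) =
    lunit (mf_fun X);
  mf_runit : forall X : C,
    fun_hom mf_fun (runit X) ∘ mf_mu X munit ∘ (mid (mf_fun X) ⊠ mf_eps) =
    runit (mf_fun X) }.

Program Definition mon_functor_id (C : moncat) : mon_functor C C :=
  @MonFunctor C C (functor_id C) (fun X Y => iso_id (X ⊗ Y)) (iso_id munit)
    _ _ _ _.
Next Obligation. by move=> *; rewrite /= mcomp1f mcompf1. Qed.
Next Obligation. by move=> *; rewrite /= !thom_id !mcompf1 !mcomp1f. Qed.
Next Obligation. by move=> *; rewrite /= !thom_id !mcompf1. Qed.
Next Obligation. by move=> *; rewrite /= !thom_id !mcompf1. Qed.

Section MonFunctorComp.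
Variables (C D E : moncat) (G : mon_functor D E) (F : mon_functor C D).

Let mu (X Y : C) : iso (G (F X) ⊗ G (F Y)) (G (F (X ⊗ Y))) :=
  iso_comp (fun_iso G (mf_mu F X Y)) (mf_mu G (F X) (F Y)).
Let eps : iso munit (G (F munit)) :=
  iso_comp (fun_iso G (mf_eps F)) (mf_eps G).

Program Definition mon_functor_comp : mon_functor C E :=
  @MonFunctor C E (functor_comp G F) mu eps _ _ _ _.
Next Obligation.
move=> X X' Y Y' f g /=.
rewrite -[LHS]mcompA (mf_mu_nat G) !mcompA -!(fun_comp G).
by rewrite (mf_mu_nat F).
Qed.
Next Obligation.
move=> X Y Z /=.
have e1 : (fun_hom G (mf_mu F X Y) ∘ mf_mu G (F X) (F Y)) ⊠ mid (G (F Z)) =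
  (fun_hom G (mf_mu F X Y) ⊠ fun_hom G (mid (F Z))) ∘
    (mf_mu G (F X) (F Y) ⊠ mid (G (F Z))).
  by rewrite -thom_comp fun_id mcomp1f.
have e2 : mid (G (F X)) ⊠ (fun_hom G (mf_mu F Y Z) ∘ mf_mu G (F Y) (F Z)) =
  (fun_hom G (mid (F X)) ⊠ fun_hom G (mf_mu F Y Z)) ∘
    (mid (G (F X)) ⊠ mf_mu G (F Y) (F Z)).
  by rewrite -thom_comp fun_id mcomp1f.
rewrite e1 e2 !mcompA -(mcompA _ (mf_mu G _ _)) (mf_mu_nat G).
rewrite -[in RHS](mcompA _ (mf_mu G _ _)) (mf_mu_nat G) !mcompA -!(fun_comp G).
rewrite (mf_assoc F) (fun_comp G _ (assoc _ _ _)).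
by rewrite -!mcompA; congr (_ ∘ _); rewrite !mcompA (mf_assoc G).
Qed.
Next Obligation.
move=> X /=.
have -> : (fun_hom G (mf_eps F) ∘ mf_eps G) ⊠ mid (G (F X)) =
  (fun_hom G (mf_eps F) ⊠ fun_hom G (mid (F X))) ∘ (mf_eps G ⊠ mid (G (F X))).
  by rewrite -thom_comp fun_id mcomp1f.
rewrite !mcompA -(mcompA _ (mf_mu G _ _)) (mf_mu_nat G) !mcompA -!(fun_comp G).
by rewrite (mf_lunit F) (mf_lunit G).
Qed.
Next Obligation.
move=> X /=.
have -> : mid (G (F X)) ⊠ (fun_hom G (mf_eps F) ∘ mf_eps G) =
  (fun_hom G (mid (F X)) ⊠ fun_hom G (mf_eps F)) ∘ (mid (G (F X)) ⊠ mf_eps G).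
  by rewrite -thom_comp fun_id mcomp1f.
rewrite !mcompA -(mcompA _ (mf_mu G _ _)) (mf_mu_nat G) !mcompA -!(fun_comp G).
by rewrite (mf_runit F) (mf_runit G).
Qed.

End MonFunctorComp.

Record mon_nat_trans (C D : moncat) (F G : mon_functor C D) := MonNatTrans {
  mnt_nt :> nat_trans F G;
  mnt_mu : forall X Y : C,
    mnt_nt (X ⊗ Y) ∘ mf_mu F X Y = mf_mu G X Y ∘ (mnt_nt X ⊠ mnt_nt Y);
  mnt_eps : mnt_nt munit ∘ mf_eps F = mf_eps G }.

Lemma mon_nat_trans_eq (C D : moncat) (F G : mon_functor C D)
    (a b : mon_nat_trans F G) : (forall X, a X = b X) -> a = b.
Proof.
case: a b => [[a an] am ae] [[b bn] bm be] /= ab.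
have e : a = b by exact: functional_extensionality_dep.
subst b; have e : an = bn by exact: Prop_irrelevance.
by subst bn; congr MonNatTrans; exact: Prop_irrelevance.
Qed.

Section MonNatTransOps.
Variables C D : moncat.

Program Definition mnt_id (F : mon_functor C D) : mon_nat_trans F F :=
  @MonNatTrans C D F F (@NatTrans C D F F (fun X => mid (F X)) _) _ _.
Next Obligation. by move=> F X Y f; rewrite mcomp1f mcompf1. Qed.
Next Obligation. by move=> F X Y /=; rewrite thom_id mcomp1f mcompf1. Qed.
Next Obligation. by move=> F /=; rewrite mcomp1f. Qed.

Program Definition mnt_comp (F G H : mon_functor C D)
    (b : mon_nat_trans G H) (a : mon_nat_trans F G) : mon_nat_trans F H :=
  @MonNatTrans C D F H (@NatTrans C D F H (fun X => b X ∘ a X) _) _ _.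
Next Obligation.
by move=> F G H b a X Y f; rewrite -mcompA nt_nat mcompA nt_nat -mcompA.
Qed.
Next Obligation.
by move=> F G H b a X Y /=; rewrite -mcompA mnt_mu mcompA mnt_mu thom_comp -mcompA.
Qed.
Next Obligation. by move=> F G H b a /=; rewrite -mcompA !mnt_eps. Qed.


Section InverseFamily.
Variables (F G : mon_functor C D) (e : forall X : C, iso (F X) (G X)).

Lemma inv_family_nat :
  (forall (X Y : C) (f : Hom X Y),
     e Y ∘ fun_hom F f = fun_hom G f ∘ e X) ->
  forall (X Y : C) (f : Hom X Y),
    iso_inv (e Y) ∘ fun_hom G f = fun_hom F f ∘ iso_inv (e X).
Proof.
move=> en X Y f; apply: (iso_cancel_l (i := e Y)).
by rewrite !mcompA iso_invK mcomp1f en -mcompA iso_invK mcompf1.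
Qed.

Lemma inv_family_mu :
  (forall X Y : C, e (X ⊗ Y) ∘ mf_mu F X Y = mf_mu G X Y ∘ (e X ⊠ e Y)) ->
  forall X Y : C, iso_inv (e (X ⊗ Y)) ∘ mf_mu G X Y =
    mf_mu F X Y ∘ (iso_inv (e X) ⊠ iso_inv (e Y)).
Proof.
move=> em X Y; apply: (iso_cancel_l (i := e (X ⊗ Y))).
by rewrite !mcompA iso_invK mcomp1f em -mcompA -thom_comp !iso_invK thom_id mcompf1.
Qed.

Lemma inv_family_eps :
  e munit ∘ mf_eps F = mf_eps G -> iso_inv (e munit) ∘ mf_eps G = mf_eps F.
Proof. by move=> <-; rewrite mcompA iso_homK mcomp1f. Qed.

End InverseFamily.

End MonNatTransOps.

Program Definition mnt_hcomp (C D E : moncat) (F F' : mon_functor C D)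
    (G G' : mon_functor D E) (b : mon_nat_trans G G') (a : mon_nat_trans F F') :
    mon_nat_trans (mon_functor_comp G F) (mon_functor_comp G' F') :=
  @MonNatTrans C E (mon_functor_comp G F) (mon_functor_comp G' F')
    (@NatTrans C E (mon_functor_comp G F) (mon_functor_comp G' F')
       (fun X => b (F' X) ∘ fun_hom G (a X)) _) _ _.
Next Obligation.
move=> C D E F F' G G' b a X Y f /=.
by rewrite -mcompA -(fun_comp G) (nt_nat a) (fun_comp G) mcompA (nt_nat b) -mcompA.
Qed.
Next Obligation.
move=> C D E F F' G G' b a X Y /=.
rewrite thom_comp !mcompA -(mcompA (b _)) -(fun_comp G) mnt_mu (fun_comp G).
rewrite -!mcompA -(mf_mu_nat G) !mcompA -(mcompA _ (mf_mu G' _ _)) -mnt_mu.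
by rewrite !mcompA nt_nat.
Qed.
Next Obligation.
move=> C D E F F' G G' b a /=.
by rewrite !mcompA -(mcompA (b _)) -(fun_comp G) mnt_eps nt_nat -mcompA mnt_eps.
Qed.

Record lin_category (k : fieldType) := LinCategory {
  lc_ob : Type;
  lc_hom : lc_ob -> lc_ob -> lmodType k;
  lc_structure : category_structure (fun X Y => lc_hom X Y : Type);
  lc_comp_linl : forall X Y Z (a : k) (g g' : lc_hom Y Z) (f : lc_hom X Y),
    cs_comp lc_structure (a *: g + g') f =
    a *: cs_comp lc_structure g f + cs_comp lc_structure g' f :> lc_hom X Z;
  lc_comp_linr : forall X Y Z (a : k) (g : lc_hom Y Z) (f f' : lc_hom X Y),
    cs_comp lc_structure g (a *: f + f') =
    a *: cs_comp lc_structure g f + cs_comp lc_structure g f' :> lc_hom X Z }.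

Coercion lin_cat (k : fieldType) (C : lin_category k) : category :=
  Category (lc_structure C).

HB.instance Definition _ (k : fieldType) (C : lin_category k) (X Y : C) :=
  GRing.Lmodule.copy (@Hom (lin_cat C) X Y) (lc_hom X Y).

Section LinTheory.
Variables (k : fieldType) (C : lin_category k).
Lemma mcomp_linl (X Y Z : C) (a : k) (g g' : Hom Y Z) (f : Hom X Y) :
  (a *: g + g') ∘ f = a *: (g ∘ f) + g' ∘ f.
Proof. exact: lc_comp_linl. Qed.
Lemma mcomp_linr (X Y Z : C) (a : k) (g : Hom Y Z) (f f' : Hom X Y) :
  g ∘ (a *: f + f') = a *: (g ∘ f) + g ∘ f'.
Proof. exact: lc_comp_linr. Qed.
Lemma mcomp0l (X Y Z : C) (f : Hom X Y) : (0 : Hom Y Z) ∘ f = 0.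
Proof.
have := mcomp_linl (-1) (0 : Hom Y Z) 0 f.
by rewrite scaler0 add0r scaleN1r addNr.
Qed.
Lemma mcomp0r (X Y Z : C) (g : Hom Y Z) : g ∘ (0 : Hom X Y) = 0.
Proof.
have := mcomp_linr (-1) g (0 : Hom X Y) 0.
by rewrite scaler0 add0r scaleN1r addNr.
Qed.
End LinTheory.

Record lin_moncat (k : fieldType) := LinMonCat {
  lm_lin :> lin_category k;
  lm_structure : monoidal_structure (lin_cat lm_lin);
  lm_thom_linl : forall (X X' Y Y' : lm_lin) (a : k)
      (f f' : Hom X X') (g : Hom Y Y'),
    ms_thom lm_structure (a *: f + f') g =
    a *: ms_thom lm_structure f g + ms_thom lm_structure f' g;
  lm_thom_linr : forall (X X' Y Y' : lm_lin) (a : k)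
      (f : Hom X X') (g g' : Hom Y Y'),
    ms_thom lm_structure f (a *: g + g') =
    a *: ms_thom lm_structure f g + ms_thom lm_structure f g' }.

Coercion lm_moncat (k : fieldType) (C : lin_moncat k) : moncat :=
  MonCat (lm_structure C).

Canonical lm_moncat.

Section LinMonTheory.
Variables (k : fieldType) (C : lin_moncat k).
Lemma thom_linl (X X' Y Y' : C) (a : k) (f f' : Hom X X') (g : Hom Y Y') :
  (a *: f + f') ⊠ g = a *: (f ⊠ g) + f' ⊠ g.
Proof. exact: lm_thom_linl. Qed.
Lemma thom_linr (X X' Y Y' : C) (a : k) (f : Hom X X') (g g' : Hom Y Y') :
  f ⊠ (a *: g + g') = a *: (f ⊠ g) + f ⊠ g'.
Proof. exact: lm_thom_linr. Qed.
End LinMonTheory.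

Record tensor_functor (k : fieldType) (C D : lin_moncat k) := TensorFunctor {
  tf_mon :> mon_functor C D;
  tf_lin : forall (X Y : C) (a : k) (f g : Hom X Y),
    fun_hom tf_mon (a *: f + g) = a *: fun_hom tf_mon f + fun_hom tf_mon g }.

Lemma tf0 (k : fieldType) (C D : lin_moncat k) (F : tensor_functor C D)
    (X Y : C) : fun_hom F (0 : Hom X Y) = 0.
Proof.
have := tf_lin F (-1) (0 : Hom X Y) 0.
by rewrite scaler0 add0r scaleN1r addNr.
Qed.

Program Definition tensor_functor_id (k : fieldType) (C : lin_moncat k) :
    tensor_functor C C :=
  @TensorFunctor k C C (mon_functor_id C) _.
Next Obligation. by []. Qed.

Program Definition tensor_functor_comp (k : fieldType) (C D E : lin_moncat k)
    (G : tensor_functor D E) (F : tensor_functor C D) : tensor_functor C E :=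
  @TensorFunctor k C E (mon_functor_comp G F) _.
Next Obligation. by move=> k C D E G F X Y a f g /=; rewrite !tf_lin. Qed.

Section Fusion.
Variables (k : fieldType) (C : lin_category k).

Definition is_direct_sum (I : finType) (X : I -> C) (Z : C) : Prop :=
  exists (inc : forall i, Hom (X i) Z) (pr : forall i, Hom Z (X i)),
    [/\ forall i, pr i ∘ inc i = mid (X i),
        forall i j, i != j -> pr j ∘ inc i = 0
      & \sum_i (inc i ∘ pr i) = mid Z].

Definition is_kernel (K X Y : C) (i : Hom K X) (f : Hom X Y) : Prop :=
  f ∘ i = 0 /\
  forall (W : C) (g : Hom W X), f ∘ g = 0 -> exists! h : Hom W K, i ∘ h = g.

Definition is_cokernel (X Y Q : C) (p : Hom Y Q) (f : Hom X Y) : Prop :=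
  p ∘ f = 0 /\
  forall (W : C) (g : Hom Y W), g ∘ f = 0 -> exists! h : Hom Q W, h ∘ p = g.

Record is_abelian : Prop := IsAbelian {
  abelian_sums : forall (n : nat) (X : 'I_n -> C), exists Z, is_direct_sum X Z;
  abelian_ker : forall (X Y : C) (f : Hom X Y),
    exists (K : C) (i : Hom K X), is_kernel i f;
  abelian_coker : forall (X Y : C) (f : Hom X Y),
    exists (Q : C) (p : Hom Y Q), is_cokernel p f;
  abelian_mono : forall (X Y : C) (i : Hom X Y), is_mono i ->
    exists (Z : C) (f : Hom Y Z), is_kernel i f;
  abelian_epi : forall (X Y : C) (p : Hom X Y), is_epi p ->
    exists (Z : C) (f : Hom Z X), is_cokernel p f }.

Definition is_zero (X : C) : Prop := mid X = 0.

Definition is_simple (X : C) : Prop :=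
  ~ is_zero X /\
  forall (Y : C) (i : Hom Y X), is_mono i -> is_zero Y \/ is_isomorphism i.

Definition is_semisimple : Prop :=
  is_abelian /\
  forall X : C, exists (n : nat) (S : 'I_n -> C),
    (forall i, is_simple (S i)) /\ is_direct_sum S X.

Definition hom_finite : Prop :=
  forall X Y : C, exists (n : nat) (b : 'I_n -> Hom X Y),
    forall f : Hom X Y, exists c : 'I_n -> k, f = \sum_i c i *: b i.

End Fusion.

Record is_fusion (k : fieldType) (C : lin_moncat k) : Prop := IsFusion {
  fusion_semisimple : is_semisimple C;
  fusion_rigid : is_rigid C;
  fusion_finite : exists (n : nat) (S : 'I_n -> C),
    forall X : C, is_simple X -> exists i, isomorphic X (S i);
  fusion_hom_finite : hom_finite C;
  fusion_end : forall S : C, is_simple S ->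
    forall f : Hom S S, exists a : k, f = a *: mid S;
  fusion_unit : is_simple (munit : C) }.

(* Stated for all k-linear monoidal categories; between fusion categories it is
   the usual notion. F X isomorphic to 1^n is expressed as F X being a direct
   sum of n copies of 1. *)
Definition is_normal_functor (k : fieldType) (C D : lin_moncat k)
    (F : tensor_functor C D) : Prop :=
  forall X : C, is_simple X ->
    (exists W : D, is_direct_sum (fun b : bool => if b then munit else W) (F X)) ->
    exists n : nat, is_direct_sum (fun _ : 'I_n => munit : D) (F X).

(* The group gT as a discrete monoidal category; Hom types are equalities. *)
Section DiscreteMonoidalCategory.
Variable gT : finGroupType.
Local Open Scope group_scope.

Program Definition disc_cat : category :=
  @Category gT (fun g h => g = h)
    (@CategoryStructure gT (fun g h => g = h) (fun g => erefl)
       (fun _ _ _ e' e => etrans e e') _ _ _).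
Solve All Obligations with by move=> *; exact: eq_irrelevance.

Definition disc_iso (g h : disc_cat) (e : g = h) : iso g h :=
  @Iso disc_cat g h e (esym e) (eq_irrelevance _ _) (eq_irrelevance _ _).

Program Definition disc : moncat :=
  @MonCat disc_cat
    (@MonoidalStructure disc_cat (fun g h : gT => g * h)
       (fun _ _ _ _ e e' => f_equal2 _ e e') 1
       (fun g h l => disc_iso (esym (mulgA g h l)))
       (fun g => disc_iso (mul1g g)) (fun g => disc_iso (mulg1 g))
       _ _ _ _ _ _ _).
Solve All Obligations with by move=> *; exact: eq_irrelevance.

End DiscreteMonoidalCategory.

Program Definition disc_functor (gT hT : finGroupType) (f : gT -> hT)
    (fM : {morph f : x y / (x * y)%g}) : mon_functor (disc gT) (disc hT) :=
  @MonFunctor (disc gT) (disc hT)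
    (@Functor (disc gT) (disc hT) f (fun _ _ e => f_equal f e) _ _)
    (fun g h => disc_iso (esym (fM g h))) (disc_iso _) _ _ _ _.
Next Obligation. by move=> *; exact: eq_irrelevance. Qed.
Next Obligation. by move=> *; exact: eq_irrelevance. Qed.
Next Obligation.
by move=> gT hT f fM; apply: (mulgI (f 1%g)); rewrite -fM !mulg1.
Qed.
Solve All Obligations with by move=> *; exact: eq_irrelevance.

Lemma is_isomorphism_comp (C : category) (X Y Z : C) (g : Hom Y Z) (f : Hom X Y) :
  is_isomorphism g -> is_isomorphism f -> is_isomorphism (g ∘ f).
Proof. by move=> [j <-] [i <-]; exists (iso_comp j i). Qed.

Lemma is_isomorphism_fun (C D : category) (F : functor C D) (X Y : C) (f : Hom X Y) :
  is_isomorphism f -> is_isomorphism (fun_hom F f).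
Proof. by move=> [i <-]; exists (fun_iso F i). Qed.

Lemma is_equivalence_id (C : category) : is_equivalence (functor_id C).
Proof.
exists (functor_id C); split.
- exists (@NatTrans C C (functor_comp (functor_id C) (functor_id C))
    (functor_id C) (fun X => mid X)
    (fun X Y f => etrans (mcomp1f _) (esym (mcompf1 _)))).
  by move=> X; exists (iso_id X).
- exists (@NatTrans C C (functor_comp (functor_id C) (functor_id C))
    (functor_id C) (fun X => mid X)
    (fun X Y f => etrans (mcomp1f _) (esym (mcompf1 _)))).
  by move=> X; exists (iso_id X).
Qed.

Lemma quasi_inverse_comp (C D E : category) (F : functor C D) (F' : functor D C)
    (G : functor D E) (G' : functor E D) :
  naturally_isomorphic (functor_comp F' F) (functor_id C) ->
  naturally_isomorphic (functor_comp G' G) (functor_id D) ->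
  naturally_isomorphic
    (functor_comp (functor_comp F' G') (functor_comp G F)) (functor_id C).
Proof.
move=> [a ai] [b bi].
have nat (X Y : C) (f : Hom X Y) :
    (a Y ∘ fun_hom F' (b (F Y))) ∘
      fun_hom (functor_comp (functor_comp F' G') (functor_comp G F)) f =
    f ∘ (a X ∘ fun_hom F' (b (F X))).
  rewrite /= -mcompA -fun_comp.
  have /= -> := nt_nat b (fun_hom F f).
  rewrite fun_comp mcompA.
  by have /= -> := nt_nat a f; rewrite mcompA.
exists (@NatTrans C C (functor_comp (functor_comp F' G') (functor_comp G F))
  (functor_id C) (fun X => a X ∘ fun_hom F' (b (F X))) nat) => X /=.
by apply: is_isomorphism_comp; [exact: ai | apply: is_isomorphism_fun; exact: bi].
Qed.

Lemma is_equivalence_comp (C D E : category) (G : functor D E)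
    (F : functor C D) :
  is_equivalence G -> is_equivalence F -> is_equivalence (functor_comp G F).
Proof.
move=> [G' [G'G GG']] [F' [F'F FF']]; exists (functor_comp F' G').
by split; apply: quasi_inverse_comp.
Qed.

(* The monoidal category of tensor autoequivalences of C: morphisms are the
   monoidal natural transformations, the tensor product is composition. *)
Section Aut.
Variables (k : fieldType) (C : lin_moncat k).

Record autoequivalence := AutoEquivalence {
  ae_tf :> tensor_functor C C;
  ae_equiv : is_equivalence ae_tf }.

Program Definition aut_cat : category :=
  @Category autoequivalence (fun F G => mon_nat_trans F G)
    (@CategoryStructure autoequivalence (fun F G => mon_nat_trans F G)
       (fun F => mnt_id F) (fun _ _ _ b a => mnt_comp b a) _ _ _).
Next Obligation.
by move=> F G a; apply: mon_nat_trans_eq => X; rewrite /= mcomp1f.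
Qed.
Next Obligation.
by move=> F G a; apply: mon_nat_trans_eq => X; rewrite /= mcompf1.
Qed.
Next Obligation.
by move=> *; apply: mon_nat_trans_eq => X; rewrite /= mcompA.
Qed.

Definition aut_unit : aut_cat :=
  @AutoEquivalence (tensor_functor_id C) (is_equivalence_id C).

Definition aut_tens (F G : aut_cat) : aut_cat :=
  @AutoEquivalence (tensor_functor_comp F G)
    (is_equivalence_comp (ae_equiv F) (ae_equiv G)).

Definition aut_thom (F F' G G' : aut_cat) (a : Hom F F') (b : Hom G G') :
  Hom (aut_tens F G) (aut_tens F' G') := mnt_hcomp a b.


(* A natural monoidal family of isomorphisms, as an isomorphism of
   autoequivalences. *)
Section AutIso.
Variables (F G : aut_cat) (e : forall X : C, iso (F X) (G X)).
Hypothesis e_nat : forall (X Y : C) (f : Hom X Y),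
  e Y ∘ fun_hom F f = fun_hom G f ∘ e X.
Hypothesis e_mu : forall X Y : C,
  e (X ⊗ Y) ∘ mf_mu F X Y = mf_mu G X Y ∘ (e X ⊠ e Y).
Hypothesis e_eps : e munit ∘ mf_eps F = mf_eps G.

Program Definition aut_iso : iso F G :=
  @Iso aut_cat F G
    (MonNatTrans (mnt_nt := NatTrans e_nat) e_mu e_eps)
    (MonNatTrans (mnt_nt := NatTrans (inv_family_nat e_nat))
       (inv_family_mu e_mu) (inv_family_eps e_eps)) _ _.
Next Obligation. by apply: mon_nat_trans_eq => X; exact: iso_homK. Qed.
Next Obligation. by apply: mon_nat_trans_eq => X; exact: iso_invK. Qed.
End AutIso.

Program Definition aut_assoc (F G H : aut_cat) :
    iso (aut_tens (aut_tens F G) H) (aut_tens F (aut_tens G H)) :=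
  @aut_iso (aut_tens (aut_tens F G) H) (aut_tens F (aut_tens G H))
    (fun X => iso_id (F (G (H X)))) _ _ _.
Next Obligation. by move=> *; rewrite /= mcomp1f mcompf1. Qed.
Next Obligation.
by move=> *; rewrite /= thom_id mcomp1f mcompf1 (fun_comp (ae_tf _)) mcompA.
Qed.
Next Obligation.
by move=> *; rewrite /= mcomp1f (fun_comp (ae_tf _)) mcompA.
Qed.

Program Definition aut_lunit (F : aut_cat) : iso (aut_tens aut_unit F) F :=
  @aut_iso (aut_tens aut_unit F) F (fun X => iso_id (F X)) _ _ _.
Next Obligation. by move=> *; rewrite /= mcomp1f mcompf1. Qed.
Next Obligation. by move=> *; rewrite /= thom_id mcomp1f !mcompf1. Qed.
Next Obligation. by move=> *; rewrite /= mcomp1f mcompf1. Qed.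

Program Definition aut_runit (F : aut_cat) : iso (aut_tens F aut_unit) F :=
  @aut_iso (aut_tens F aut_unit) F (fun X => iso_id (F X)) _ _ _.
Next Obligation. by move=> *; rewrite /= mcomp1f mcompf1. Qed.
Next Obligation.
by move=> *; rewrite /= thom_id fun_id !mcomp1f mcompf1.
Qed.
Next Obligation. by move=> *; rewrite /= fun_id !mcomp1f. Qed.

Program Definition aut_tensor : moncat :=
  @MonCat aut_cat
    (@MonoidalStructure aut_cat aut_tens aut_thom aut_unit aut_assoc
       aut_lunit aut_runit _ _ _ _ _ _ _).
Next Obligation.
by move=> F G; apply: mon_nat_trans_eq => X; rewrite /= fun_id mcomp1f.
Qed.
Next Obligation.
move=> F F' F'' G G' G'' a' a b' b; apply: mon_nat_trans_eq => X /=.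
by rewrite (fun_comp (ae_tf _)) !mcompA -(mcompA _ (a _)) (nt_nat a) !mcompA.
Qed.
Next Obligation.
move=> F F' G G' H H' a b c; apply: mon_nat_trans_eq => X /=.
by rewrite mcomp1f mcompf1 (fun_comp (ae_tf _)) mcompA.
Qed.
Next Obligation.
by move=> F F' a; apply: mon_nat_trans_eq => X; rewrite /= !mcomp1f mcompf1.
Qed.
Next Obligation.
by move=> F F' a; apply: mon_nat_trans_eq => X;
  rewrite /= fun_id !mcompf1 mcomp1f.
Qed.
Next Obligation.
by move=> F G; apply: mon_nat_trans_eq => X; rewrite /= !fun_id !mcomp1f.
Qed.
Next Obligation.
by move=> F G H K; apply: mon_nat_trans_eq => X; rewrite /= !fun_id !mcomp1f.
Qed.

End Aut.

Definition tensor_action (gT : finGroupType) (k : fieldType) (C : lin_moncat k) :=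
  mon_functor (disc gT) (aut_tensor C).

Definition restrict_action (gT : finGroupType) (k : fieldType)
    (C : lin_moncat k) (rho : tensor_action gT C) (H : {group gT}) :
    tensor_action (subg_of H) C :=
  mon_functor_comp rho
    (@disc_functor (subg_of H) gT sgval (fun x y => sgvalM (in_setT x) (in_setT y))).

Section Equivariantization.
Variables (gT : finGroupType) (k : fieldType) (C : lin_moncat k).
Variable rho : tensor_action gT C.

Definition act_functor (g : gT) : tensor_functor C C := ae_tf (mf_fun rho g).

Definition act_mu (g h : gT) :
    mon_nat_trans (mon_functor_comp (act_functor g) (act_functor h)) (act_functor (g * h)%g) :=
  iso_hom (mf_mu rho g h).

Definition act_eps : mon_nat_trans (mon_functor_id C) (act_functor 1%g) :=
  iso_hom (mf_eps rho).

Record eqv_object := EqObject {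
  eo_ob : C;
  eo_r : forall g : gT, iso (act_functor g eo_ob) eo_ob;
  eo_mul : forall g h : gT,
    eo_r g ∘ fun_hom (act_functor g) (eo_r h) = eo_r (g * h)%g ∘ act_mu g h eo_ob;
  eo_unit : eo_r 1%g ∘ act_eps eo_ob = mid eo_ob }.

Section EqHom.
Variables X Y : eqv_object.

Definition is_equivariant : pred (Hom (eo_ob X) (eo_ob Y)) :=
  fun f => [forall g : gT, f ∘ eo_r X g == eo_r Y g ∘ fun_hom (act_functor g) f].

(* The predicate is boolean because gT is finite, so that the subtype of
   equivariant morphisms inherits the k-module structure of Hom in C. *)
Record eqv_hom := EqHom {
  eh_hom : Hom (eo_ob X) (eo_ob Y);
  eh_equivariant : is_equivariant eh_hom }.

Lemma eqv_homP (f : eqv_hom) (g : gT) :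
  eh_hom f ∘ eo_r X g = eo_r Y g ∘ fun_hom (act_functor g) (eh_hom f).
Proof. exact/eqP/(forallP (eh_equivariant f)). Qed.

Lemma is_equivariant_submod : submod_closed is_equivariant.
Proof.
have lin a f f' : is_equivariant f -> is_equivariant f' ->
    is_equivariant (a *: f + f').
  move=> /forallP ef /forallP ef'; apply/forallP => g.
  by rewrite tf_lin mcomp_linl mcomp_linr (eqP (ef g)) (eqP (ef' g)).
split=> [|a f f']; last exact: lin.
apply/forallP => g.
by rewrite tf0 mcomp0l mcomp0r.
Qed.

HB.instance Definition _ := GRing.isSubmodClosed.Build k
  (Hom (eo_ob X) (eo_ob Y)) is_equivariant is_equivariant_submod.

HB.instance Definition _ := [isSub for eh_hom].
HB.instance Definition _ := [Choice of eqv_hom by <:].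
HB.instance Definition _ := [SubChoice_isSubLmodule of eqv_hom by <:].

End EqHom.

Lemma eqv_hom_inj (X Y : eqv_object) (f g : eqv_hom X Y) :
  eh_hom f = eh_hom g -> f = g.
Proof. exact: val_inj. Qed.

Program Definition eqv_id (X : eqv_object) : eqv_hom X X :=
  @EqHom X X (mid (eo_ob X)) _.
Next Obligation.
by move=> X; apply/forallP => g; rewrite fun_id mcomp1f mcompf1.
Qed.

Program Definition eqv_comp (X Y Z : eqv_object) (g : eqv_hom Y Z)
    (f : eqv_hom X Y) : eqv_hom X Z := @EqHom X Z (eh_hom g ∘ eh_hom f) _.
Next Obligation.
move=> X Y Z g f; apply/forallP => x; apply/eqP.
by rewrite fun_comp mcompA -eqv_homP -mcompA eqv_homP mcompA.
Qed.

Program Definition eqv_lin_category : lin_category k :=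
  @LinCategory k eqv_object (fun X Y => eqv_hom X Y : lmodType k)
    (@CategoryStructure eqv_object eqv_hom eqv_id eqv_comp _ _ _) _ _.
Next Obligation. by move=> *; apply: eqv_hom_inj; rewrite /= mcomp1f. Qed.
Next Obligation. by move=> *; apply: eqv_hom_inj; rewrite /= mcompf1. Qed.
Next Obligation. by move=> *; apply: eqv_hom_inj; rewrite /= mcompA. Qed.
Next Obligation. by move=> *; apply: eqv_hom_inj; exact: mcomp_linl. Qed.
Next Obligation. by move=> *; apply: eqv_hom_inj; exact: mcomp_linr. Qed.

Program Definition eqv_iso (X Y : eqv_object) (i : iso (eo_ob X) (eo_ob Y))
    (ei : forall g : gT, i ∘ eo_r X g = eo_r Y g ∘ fun_hom (act_functor g) i) :
    @iso eqv_lin_category X Y :=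
  @Iso eqv_lin_category X Y (@EqHom X Y i _) (@EqHom Y X (iso_inv i) _) _ _.
Next Obligation. by move=> X Y i ei; apply/forallP => g; apply/eqP; exact: ei. Qed.
Next Obligation.
move=> X Y i ei; apply/forallP => g; apply/eqP.
apply: (iso_cancel_l (i := i)); rewrite mcompA iso_invK mcomp1f mcompA ei.
by rewrite -mcompA -fun_comp iso_invK fun_id mcompf1.
Qed.
Next Obligation. by move=> X Y i ei; apply: eqv_hom_inj; exact: iso_homK. Qed.
Next Obligation. by move=> X Y i ei; apply: eqv_hom_inj; exact: iso_invK. Qed.

Definition eqv_tens_r (X Y : eqv_object) (g : gT) :
    iso (act_functor g (eo_ob X ⊗ eo_ob Y)) (eo_ob X ⊗ eo_ob Y) :=
  iso_comp (thom_iso (eo_r X g) (eo_r Y g))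
    (iso_sym (mf_mu (act_functor g) (eo_ob X) (eo_ob Y))).

Lemma eqv_tens_rE (X Y : eqv_object) (g : gT) :
  eqv_tens_r X Y g ∘ mf_mu (act_functor g) (eo_ob X) (eo_ob Y) = eo_r X g ⊠ eo_r Y g.
Proof. by rewrite /= -mcompA iso_homK mcompf1. Qed.

Program Definition eqv_tens (X Y : eqv_object) : eqv_object :=
  @EqObject (eo_ob X ⊗ eo_ob Y) (eqv_tens_r X Y) _ _.
Next Obligation.
move=> X Y g h.
apply: (iso_cancel_r
  (i := mf_mu (mon_functor_comp (act_functor g) (act_functor h)) (eo_ob X) (eo_ob Y))).
rewrite -[RHS]mcompA mnt_mu mcompA eqv_tens_rE -thom_comp -!eo_mul.
rewrite [mf_mu (mon_functor_comp _ _) _ _]/= mcompA -(mcompA (eqv_tens_r X Y g)).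
rewrite -fun_comp eqv_tens_rE -mcompA -(mf_mu_nat (act_functor g)) mcompA eqv_tens_rE.
by rewrite thom_comp.
Qed.
Next Obligation.
move=> X Y.
have := mnt_mu act_eps (eo_ob X) (eo_ob Y).
rewrite /= mcompf1 => ->.
by rewrite mcompA eqv_tens_rE -thom_comp !eo_unit thom_id.
Qed.

Program Definition eqv_thom (X X' Y Y' : eqv_object) (f : eqv_hom X X')
    (g : eqv_hom Y Y') : eqv_hom (eqv_tens X Y) (eqv_tens X' Y') :=
  @EqHom (eqv_tens X Y) (eqv_tens X' Y') (eh_hom f ⊠ eh_hom g) _.
Next Obligation.
move=> X X' Y Y' f g; apply/forallP => x; apply/eqP.
apply: (iso_cancel_r (i := mf_mu (act_functor x) (eo_ob X) (eo_ob Y))).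
rewrite -mcompA eqv_tens_rE -[RHS]mcompA -(mf_mu_nat (act_functor x)) mcompA eqv_tens_rE.
by rewrite -!thom_comp !eqv_homP.
Qed.

Definition eqv_unit_r (g : gT) : iso (act_functor g munit) munit :=
  iso_sym (mf_eps (act_functor g)).

Program Definition eqv_unit : eqv_object := @EqObject munit eqv_unit_r _ _.
Next Obligation.
move=> g h.
apply: (iso_cancel_r (i := mf_eps (mon_functor_comp (act_functor g) (act_functor h)))).
rewrite -[RHS]mcompA mnt_eps iso_homK /= mcompA -(mcompA (iso_inv _)) -fun_comp.
by rewrite iso_homK fun_id mcompf1 iso_homK.
Qed.
Next Obligation.
have := mnt_eps act_eps; rewrite /= mcompf1 => ->.
by rewrite iso_homK.
Qed.

Program Definition eqv_assoc (X Y Z : eqv_object) :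
    @iso eqv_lin_category (eqv_tens (eqv_tens X Y) Z) (eqv_tens X (eqv_tens Y Z)) :=
  @eqv_iso (eqv_tens (eqv_tens X Y) Z) (eqv_tens X (eqv_tens Y Z))
    (assoc (eo_ob X) (eo_ob Y) (eo_ob Z)) _.
Next Obligation.
move=> X Y Z g.
apply: (iso_cancel_r
  (i := iso_comp (mf_mu (act_functor g) (eo_ob X ⊗ eo_ob Y) (eo_ob Z))
    (thom_iso (mf_mu (act_functor g) (eo_ob X) (eo_ob Y)) (iso_id _)))).
rewrite -[LHS]mcompA -[RHS]mcompA.
have -> : eo_r (eqv_tens (eqv_tens X Y) Z) g ∘
    iso_comp (mf_mu (act_functor g) (eo_ob X ⊗ eo_ob Y) (eo_ob Z))
      (thom_iso (mf_mu (act_functor g) (eo_ob X) (eo_ob Y)) (iso_id _)) =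
    (eo_r X g ⊠ eo_r Y g) ⊠ eo_r Z g.
  rewrite mcompA (eqv_tens_rE (eqv_tens X Y) Z) -thom_comp eqv_tens_rE.
  by rewrite mcompf1.
rewrite assoc_nat [iso_hom (iso_comp _ _)]/= (mcompA _ (mf_mu _ _ _)) mf_assoc.
rewrite !mcompA (eqv_tens_rE X (eqv_tens Y Z)) -thom_comp eqv_tens_rE.
by rewrite mcompf1.
Qed.

Program Definition eqv_lunit (X : eqv_object) :
    @iso eqv_lin_category (eqv_tens eqv_unit X) X :=
  @eqv_iso (eqv_tens eqv_unit X) X (lunit (eo_ob X)) _.
Next Obligation.
move=> X g.
pose i := iso_comp (mf_mu (act_functor g) munit (eo_ob X))
  (thom_iso (mf_eps (act_functor g)) (iso_id _)).
apply: (iso_cancel_r (i := i)).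
have e : fun_hom (act_functor g) (lunit (eo_ob X)) ∘ i = lunit (act_functor g (eo_ob X)).
  by rewrite -mf_lunit /= !mcompA.
rewrite -[LHS]mcompA -[RHS]mcompA e -lunit_nat; congr (_ ∘ _).
rewrite [iso_hom i]/= mcompA (eqv_tens_rE eqv_unit X) -thom_comp mcompf1.
by rewrite iso_homK.
Qed.

Program Definition eqv_runit (X : eqv_object) :
    @iso eqv_lin_category (eqv_tens X eqv_unit) X :=
  @eqv_iso (eqv_tens X eqv_unit) X (runit (eo_ob X)) _.
Next Obligation.
move=> X g.
pose i := iso_comp (mf_mu (act_functor g) (eo_ob X) munit)
  (thom_iso (iso_id _) (mf_eps (act_functor g))).
apply: (iso_cancel_r (i := i)).
have e : fun_hom (act_functor g) (runit (eo_ob X)) ∘ i = runit (act_functor g (eo_ob X)).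
  by rewrite -mf_runit /= !mcompA.
rewrite -[LHS]mcompA -[RHS]mcompA e -runit_nat; congr (_ ∘ _).
rewrite [iso_hom i]/= mcompA (eqv_tens_rE X eqv_unit) -thom_comp mcompf1.
by rewrite iso_homK.
Qed.

Program Definition equivariantization : lin_moncat k :=
  @LinMonCat k eqv_lin_category
    (@MonoidalStructure (lin_cat eqv_lin_category) eqv_tens eqv_thom eqv_unit
       eqv_assoc eqv_lunit eqv_runit _ _ _ _ _ _ _) _ _.
Next Obligation. by move=> *; apply: eqv_hom_inj; exact: thom_id. Qed.
Next Obligation. by move=> *; apply: eqv_hom_inj; exact: thom_comp. Qed.
Next Obligation. by move=> *; apply: eqv_hom_inj; exact: assoc_nat. Qed.
Next Obligation. by move=> *; apply: eqv_hom_inj; exact: lunit_nat. Qed.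
Next Obligation. by move=> *; apply: eqv_hom_inj; exact: runit_nat. Qed.
Next Obligation. by move=> *; apply: eqv_hom_inj; exact: triangle. Qed.
Next Obligation. by move=> *; apply: eqv_hom_inj; exact: pentagon. Qed.
Next Obligation. by move=> *; apply: eqv_hom_inj; exact: thom_linl. Qed.
Next Obligation. by move=> *; apply: eqv_hom_inj; exact: thom_linr. Qed.

Program Definition forgetful_functor : tensor_functor equivariantization C :=
  @TensorFunctor k equivariantization C
    (@MonFunctor equivariantization C
       (@Functor equivariantization C eo_ob (fun X Y f => eh_hom f) _ _)
       (fun X Y => iso_id (eo_ob X ⊗ eo_ob Y)) (iso_id munit) _ _ _ _) _.
Next Obligation. by []. Qed.
Next Obligation. by []. Qed.
Next Obligation. by move=> *; rewrite /= mcomp1f mcompf1. Qed.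
Next Obligation. by move=> *; rewrite /= !thom_id !mcompf1 mcomp1f. Qed.
Next Obligation. by move=> *; rewrite /= !thom_id !mcompf1. Qed.
Next Obligation. by move=> *; rewrite /= !thom_id !mcompf1. Qed.
Next Obligation. by []. Qed.

Lemma eo_r_eq (X : eqv_object) (g g' : disc gT) (e : Hom g g') :
  eo_r X g' ∘ mnt_nt (fun_hom rho e) (eo_ob X) = eo_r X g.
Proof.
case: g' / e; rewrite (fun_id rho g : fun_hom rho (erefl g) = _).
exact: mcompf1.
Qed.

End Equivariantization.

Section Restriction.
Variables (gT : finGroupType) (k : fieldType) (C : lin_moncat k).
Variables (rho : tensor_action gT C) (H : {group gT}).

Program Definition restrict_ob (X : equivariantization rho) :
    equivariantization (restrict_action rho H) :=
  @EqObject _ k C (restrict_action rho H) (eo_ob X)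
    (fun h => eo_r X (sgval h)) _ _.
Next Obligation.
move=> X g h.
have e := eo_r_eq X (esym (sgvalM (in_setT g) (in_setT h))).
apply: etrans (eo_mul X (sgval g) (sgval h)) _.
exact: etrans (congr1 (fun u => u ∘ _) (esym e)) (esym (mcompA _ _ _)).
Qed.
Next Obligation.
move=> X; apply: etrans (eo_unit X).
have e := eo_r_eq X (mf_eps (@disc_functor (subg_of H) gT sgval
  (fun x y => sgvalM (in_setT x) (in_setT y)))).
exact: etrans (mcompA _ _ _) (congr1 (fun u => u ∘ _) e).
Qed.

Program Definition restrict_hom (X Y : equivariantization rho)
    (f : Hom X Y) : Hom (restrict_ob X) (restrict_ob Y) :=
  @EqHom _ k C (restrict_action rho H) (restrict_ob X) (restrict_ob Y)
    (eh_hom f) _.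
Next Obligation.
by move=> X Y f; apply/forallP => h; apply/eqP; exact: eqv_homP f (sgval h).
Qed.

Program Definition restrict_mu (X Y : equivariantization rho) :
    iso (restrict_ob X ⊗ restrict_ob Y) (restrict_ob (X ⊗ Y)) :=
  @eqv_iso _ k C (restrict_action rho H)
    (restrict_ob X ⊗ restrict_ob Y) (restrict_ob (X ⊗ Y))
    (iso_id (eo_ob X ⊗ eo_ob Y)) _.
Next Obligation.
move=> X Y h; by rewrite mcomp1f fun_id mcompf1.
Qed.

Program Definition restrict_eps :
    @iso (equivariantization (restrict_action rho H)) munit
      (restrict_ob munit) :=
  @eqv_iso _ k C (restrict_action rho H) (eqv_unit _) (restrict_ob munit)
    (iso_id munit) _.
Next Obligation.
move=> h; by rewrite mcomp1f fun_id mcompf1.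
Qed.

Program Definition restriction_functor :
    tensor_functor (equivariantization rho)
      (equivariantization (restrict_action rho H)) :=
  @TensorFunctor k _ _
    (@MonFunctor _ _
       (@Functor (equivariantization rho)
          (equivariantization (restrict_action rho H))
          restrict_ob restrict_hom _ _)
       restrict_mu restrict_eps _ _ _ _) _.
Next Obligation. by move=> *; apply: eqv_hom_inj. Qed.
Next Obligation. by move=> *; apply: eqv_hom_inj. Qed.
Next Obligation.
by move=> *; apply: eqv_hom_inj; rewrite /= mcomp1f mcompf1.
Qed.
Next Obligation.
by move=> *; apply: eqv_hom_inj; rewrite /= !thom_id !mcompf1 mcomp1f.
Qed.
Next Obligation.
by move=> *; apply: eqv_hom_inj; rewrite /= !thom_id !mcompf1.
Qed.
Next Obligation.
by move=> *; apply: eqv_hom_inj; rewrite /= !thom_id !mcompf1.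
Qed.
Next Obligation. by move=> *; apply: eqv_hom_inj. Qed.

End Restriction.

(* Main.v *)
(* Write V for the G-module Hom(1, X) of an object X of C^G.

    If H is normal, the H-invariants of V form a G-submodule, and its span
    1^n -> X is a subobject of X in C^G; when X is simple and the submodule is
    nonzero this subobject is all of X, and H acts trivially on it.

    Conversely, an irreducible k[G]-module M gives a simple object M ⊗ 1 of C^G.
    If M occurs in k[H\G], evaluation at the trivial coset is a nonzero
    H-invariant functional on M, so that 1 is a direct summand of the
    restriction to C^H, and normality of the functor forces H to act trivially
    on M. By Maschke's theorem H then acts trivially on k[H\G].

    For H normal and X in C^H, the isomorphisms rho(gh)(X) -> rho(g)(X), for
    h in H, identify all the rho(g)(X) with g in a given coset of H. Hence a
    coset q acts by rho(g) for any representative g of q, and all coherence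
    conditions follow from the functoriality of these identifications. *)
From HB Require Import structures.
From mathcomp Require Import all_boot all_algebra all_fingroup all_solvable.
From mathcomp Require Import all_character boolp.
Require Import Defs.

Set Implicit Arguments.
Unset Strict Implicit.
Unset Printing Implicit Defensive.

Import GRing.Theory.
Local Open Scope ring_scope.
Local Open Scope cat_scope.

(** * Actions of a finite group *)

(** Only C is given as a fusion category, so facts about C^G and C^H are obtained by constructing
    morphisms in C and then making them equivariant. A retract in C whose image is stable under the
    structure maps yields a subobject in C^G, even when its retraction is not equivariant; a
    splitting in C is averaged over G.

    For the quotient action the obstacle is that coset representatives are not multiplicative, so
    each constraint of rho is followed by a change of representative. Coherence rests on three
    properties of these changes: they compose as a cocycle, they are natural and monoidal, and they
    commute with rho(a)rho(g) -> rho(ag) in each of the variables a and g. The variable a is where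
    normality of H enters. Each diagram then reduces to associativity of rho followed by a single
    change of representative.

    The triangle is an equality of tensor functors, not an isomorphism, so K keeps the restricted
    object and morphism as underlying data and only adds structure maps. *)

Program Definition aut_iso_app (k : fieldType) (C : lin_moncat k)
    (F G : aut_tensor C) (i : iso F G) (X : C) : iso (ae_tf F X) (ae_tf G X) :=
  @Iso C (ae_tf F X) (ae_tf G X) (mnt_nt (iso_hom i) X) (mnt_nt (iso_inv i) X) _ _.
Next Obligation.
move=> k C F G i X.
exact: (congr1 (fun a : mon_nat_trans (ae_tf F) (ae_tf F) => mnt_nt a X) (iso_homK i)).
Qed.
Next Obligation.
move=> k C F G i X.
exact: (congr1 (fun a : mon_nat_trans (ae_tf G) (ae_tf G) => mnt_nt a X) (iso_invK i)).
Qed.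

Lemma equivalence_faithful (C D : category) (F : functor C D) (X Y : C)
    (f g : Hom X Y) : is_equivalence F -> fun_hom F f = fun_hom F g -> f = g.
Proof.
move=> [G [[a ai] _]] fg; have [i iE] := ai X.
apply: (iso_cancel_r (i := i)); rewrite iE.
have /= <- := nt_nat a f; have /= <- := nt_nat a g.
by rewrite fg.
Qed.

Section ActionCalculus.
Variables (gT : finGroupType) (k : fieldType) (C : lin_moncat k).
Variable rho : tensor_action gT C.
Local Notation act := (act_functor rho).

Definition act_transport (g g' : gT) (e : g = g') :
    iso (mf_fun rho g) (mf_fun rho g') :=
  fun_iso rho (disc_iso e).

Lemma transport_id (g : gT) (e : g = g) (X : C) :
  mnt_nt (fun_hom rho (e : @Hom (disc gT) g g)) X = mid (act g X).
Proof.
have -> : e = erefl by exact: eq_irrelevance.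
exact: (congr1 (fun a : mon_nat_trans _ _ => mnt_nt a X) (fun_id rho g)).
Qed.

Lemma transport_comp (g h l : gT) (e : g = h) (e' : h = l) (X : C) :
  mnt_nt (fun_hom rho (e' : @Hom (disc gT) h l)) X ∘
    mnt_nt (fun_hom rho (e : @Hom (disc gT) g h)) X =
  mnt_nt (fun_hom rho (etrans e e' : @Hom (disc gT) g l)) X.
Proof. by subst h l; rewrite !transport_id mcomp1f. Qed.

(* The constraint rho(g) rho(h) -> rho(gh) with its target named by an equation,
   so that no transport along associativity of gT is needed afterwards. *)
Definition act_mul (g h l : gT) (e : (g * h)%g = l) (X : C) :
    iso (act g (act h X)) (act l X) :=
  locked (aut_iso_app (iso_comp (act_transport e) (mf_mu rho g h)) X).

Definition act_one (X : C) : iso X (act 1%g X) :=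
  locked (aut_iso_app (mf_eps rho) X).

Lemma act_oneE (X : C) : act_one X = act_eps rho X :> Hom _ _.
Proof. by rewrite /act_one -lock. Qed.

Lemma act_mul_erefl (g h : gT) (X : C) :
  act_mul (erefl (g * h)%g) X = act_mu rho g h X :> Hom _ _.
Proof.
rewrite /act_mul -lock /=.
have -> : fun_hom rho (erefl (g * h)%g) = mnt_id (act (g * h)%g) by exact: (fun_id rho).
exact: (@mcomp1f C _ _ (act_mu rho g h X)).
Qed.

Lemma act_mul_nat (g h l : gT) (e : (g * h)%g = l) (X Y : C) (f : Hom X Y) :
  act_mul e Y ∘ fun_hom (act g) (fun_hom (act h) f) =
  fun_hom (act l) f ∘ act_mul e X.
Proof.
rewrite /act_mul -!lock.
exact: nt_nat (mnt_nt (iso_hom (iso_comp (act_transport e) (mf_mu rho g h)))) X Y f.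
Qed.

Lemma act_mul_tens (g h l : gT) (e : (g * h)%g = l) (X Y : C) :
  act_mul e (X ⊗ Y) ∘ (fun_hom (act g) (mf_mu (act h) X Y) ∘
    mf_mu (act g) (act h X) (act h Y)) =
  mf_mu (act l) X Y ∘ (act_mul e X ⊠ act_mul e Y).
Proof.
rewrite /act_mul -!lock.
exact: mnt_mu (iso_hom (iso_comp (act_transport e) (mf_mu rho g h))) X Y.
Qed.

Lemma act_mul_unit (g h l : gT) (e : (g * h)%g = l) :
  act_mul e munit ∘ (fun_hom (act g) (mf_eps (act h)) ∘ mf_eps (act g)) =
  mf_eps (act l).
Proof.
rewrite /act_mul -lock.
exact: mnt_eps (iso_hom (iso_comp (act_transport e) (mf_mu rho g h))).
Qed.

Lemma act_mulA (g h l a b m : gT) (ga : (g * h)%g = a) (am : (a * l)%g = m)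
    (hb : (h * l)%g = b) (gm : (g * b)%g = m) (X : C) :
  act_mul am X ∘ act_mul ga (act l X) =
  act_mul gm X ∘ fun_hom (act g) (act_mul hb X).
Proof.
subst a b m; rewrite !act_mul_erefl.
have e : mnt_nt (fun_hom rho (iso_hom (disc_iso (esym (mulgA g h l))))) X ∘
    act_mu rho (g * h)%g l X ∘ act_mu rho g h (act l X) =
    act_mu rho g (h * l)%g X ∘ fun_hom (act g) (act_mu rho h l X).
  have := congr1 (fun a : mon_nat_trans _ _ => mnt_nt a X) (mf_assoc rho g h l).
  by rewrite /= !fun_id !mcompf1 mcomp1f.
rewrite [act_mul gm]/act_mul -lock [X in _ = X ∘ _]/= -mcompA.
apply: etrans (congr1 (fun u => _ ∘ u) e); rewrite !mcompA.
by rewrite transport_comp transport_id mcomp1f.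
Qed.

Lemma act_one_nat (X Y : C) (f : Hom X Y) :
  act_one Y ∘ f = fun_hom (act 1%g) f ∘ act_one X.
Proof. rewrite /act_one -!lock; exact: nt_nat (mnt_nt (iso_hom (mf_eps rho))) X Y f. Qed.

Lemma act_one_tens (X Y : C) :
  act_one (X ⊗ Y) = mf_mu (act 1%g) X Y ∘ (act_one X ⊠ act_one Y) :> Hom _ _.
Proof. by rewrite /act_one -!lock -(mnt_mu (iso_hom (mf_eps rho)) X Y) mcompf1. Qed.

Lemma act_one_unit : act_one munit = mf_eps (act 1%g) :> Hom _ _.
Proof. by rewrite /act_one -lock -(mnt_eps (iso_hom (mf_eps rho))) mcompf1. Qed.

Lemma act_mul1 (g : gT) (e : (1 * g)%g = g) (X : C) :
  act_mul e X ∘ act_one (act g X) = mid (act g X).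
Proof.
have := congr1 (fun a : mon_nat_trans _ _ => mnt_nt a X) (mf_lunit rho g).
have -> : e = mul1g g by exact: eq_irrelevance.
by rewrite /act_mul /act_one -!lock /= mcompf1.
Qed.

Lemma act_mulr1 (g : gT) (e : (g * 1)%g = g) (X : C) :
  act_mul e X ∘ fun_hom (act g) (act_one X) = mid (act g X).
Proof.
have := congr1 (fun a : mon_nat_trans _ _ => mnt_nt a X) (mf_runit rho g).
have -> : e = mulg1 g by exact: eq_irrelevance.
by rewrite /act_mul /act_one -!lock /= mcomp1f.
Qed.

Lemma eo_r_mul (X : eqv_object rho) (g h l : gT) (e : (g * h)%g = l) :
  eo_r X g ∘ fun_hom (act g) (eo_r X h) = eo_r X l ∘ act_mul e (eo_ob X).
Proof. by subst l; rewrite act_mul_erefl eo_mul. Qed.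

Section Family.
Variables (X : C) (r : forall g : gT, Hom (act g X) X).
Hypothesis r_mul : forall g h : gT,
  r g ∘ fun_hom (act g) (r h) = r (g * h)%g ∘ act_mu rho g h X.
Hypothesis r_one : r 1%g ∘ act_one X = mid X.

(** The action law at g and g^-1 gives r_1 up to the constraint, and r_1 is a left inverse of the
    isomorphism [act_one]. *)
Lemma family_split (g : gT) : exists q : Hom X (act g X), r g ∘ q = mid X.
Proof.
pose e := mulgV g.
have rM : r g ∘ fun_hom (act g) (r g^-1%g) = r 1%g ∘ act_mul e X.
  by rewrite r_mul -act_mul_erefl; case: _ / e.
exists (fun_hom (act g) (r g^-1%g) ∘ (iso_inv (act_mul e X) ∘ act_one X)).
rewrite !mcompA rM -(mcompA (r 1%g)).
by rewrite iso_invK mcompf1 r_one.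
Qed.

(* A right inverse of r_(g^-1) makes rho(g^-1)(r_g) a split monomorphism, and
   rho(g^-1) is faithful. *)
Lemma family_inverse (g : gT) :
  exists q : Hom X (act g X), q ∘ r g = mid (act g X) /\ r g ∘ q = mid X.
Proof.
have [q rq] := family_split g; exists q; split=> //.
suff inj (u v : Hom (act g X) (act g X)) : r g ∘ u = r g ∘ v -> u = v.
  by apply: inj; rewrite mcompA rq mcomp1f mcompf1.
move=> uv; apply: (equivalence_faithful (ae_equiv (mf_fun rho g^-1%g))).
pose e := mulVg g.
have rM : r g^-1%g ∘ fun_hom (act g^-1%g) (r g) = r 1%g ∘ act_mul e X.
  by rewrite r_mul -act_mul_erefl; case: _ / e.
have r1 : r 1%g = iso_inv (act_one X).
  by apply: (iso_cancel_r (i := act_one X)); rewrite r_one iso_homK.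
apply: (iso_cancel_l (i := iso_comp (iso_sym (act_one X)) (act_mul e X))).
rewrite /= -r1 -rM -!mcompA -!(fun_comp (act g^-1%g)).
by rewrite uv.
Qed.

(** The inverse comes from choice, but the forward map is [r g] by conversion, so [r_mul] serves
    unchanged as the multiplicativity axiom of [family_object]. *)
Definition family_iso (g : gT) : iso (act g X) X :=
  Iso (proj1 (projT2 (cid (family_inverse g))))
      (proj2 (projT2 (cid (family_inverse g)))).

Definition family_object : eqv_object rho :=
  @EqObject gT k C rho X family_iso r_mul
    (etrans (congr1 (fun u => r 1%g ∘ u) (esym (act_oneE X))) r_one).

End Family.

End ActionCalculus.

(** * The action of the quotient group *)

Section Swap.
Variables (gT : finGroupType) (k : fieldType) (C : lin_moncat k).
Variables (rho : tensor_action gT C) (H : {group gT}).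
Local Notation act := (act_functor rho).
Local Notation act_mul := (act_mul rho).
Local Notation act_one := (act_one rho).
Local Notation CH := (equivariantization (restrict_action rho H)).

Lemma restrict_act_mu (h l : subg_of H) (e : (sgval h * sgval l)%g = sgval (h * l)%g)
    (X : C) : act_mu (restrict_action rho H) h l X = act_mul e X :> Hom _ _.
Proof.
rewrite /act_mul -lock.
by have -> : e = esym (sgvalM (in_setT h) (in_setT l)) by exact: eq_irrelevance.
Qed.

Lemma restrict_act_eps (X : C) :
  act_eps (restrict_action rho H) X = act_one X :> Hom _ _.
Proof.
rewrite act_oneE -[RHS]mcomp1f.
pose e : 1%g = sgval (1%g : subg_of H) := iso_hom (mf_eps (disc_functor
  (fun x y : subg_of H => sgvalM (in_setT x) (in_setT y)))).
exact: (congr1 (fun u => u ∘ act_eps rho X) (@transport_id _ _ _ rho 1%g e X)).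
Qed.

(** Indexed by an element of gT with a membership proof instead of an element of [subg_of H], so
    that products are taken in gT and [act_mul] applies directly. *)
Definition sub_r (X : CH) (h : gT) (hH : h \in H) : iso (act h (eo_ob X)) (eo_ob X) :=
  locked (eo_r X (Subg hH)).

Lemma eo_r_sub (X : CH) (h : subg_of H) :
  eo_r X h = sub_r X (subgP h) :> Hom (act (sgval h) (eo_ob X)) _.
Proof. by rewrite /sub_r -lock; case: h => h hH; congr (iso_hom (eo_r X (Subg _))). Qed.

Lemma sub_r_mul (X : CH) (g h l : gT) (e : (g * h)%g = l)
    (gH : g \in H) (hH : h \in H) (lH : l \in H) :
  sub_r X gH ∘ fun_hom (act g) (sub_r X hH) = sub_r X lH ∘ act_mul e (eo_ob X).
Proof.
have := eo_mul X (Subg gH) (Subg hH).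
rewrite (@restrict_act_mu _ _ erefl) !eo_r_sub; subst l.
rewrite (bool_irrelevance (subgP (Subg gH)) gH) (bool_irrelevance (subgP (Subg hH)) hH).
by rewrite (bool_irrelevance (subgP (Subg gH * Subg hH)%g) lH).
Qed.

Lemma sub_r_one (X : CH) (h1 : 1%g \in H) : sub_r X h1 ∘ act_one (eo_ob X) = mid _.
Proof.
have := eo_unit X; rewrite restrict_act_eps eo_r_sub.
by rewrite (bool_irrelevance (subgP (1%g : subg_of H)) h1).
Qed.

Lemma sub_r_hom (X Y : CH) (f : Hom X Y) (h : gT) (hH : h \in H) :
  eh_hom f ∘ sub_r X hH = sub_r Y hH ∘ fun_hom (act h) (eh_hom f).
Proof. by rewrite /sub_r -!lock; exact: eqv_homP f (Subg hH). Qed.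

Lemma sub_r_tens (X Y : CH) (h : gT) (hH : h \in H) :
  sub_r (X ⊗ Y) hH ∘ mf_mu (act h) (eo_ob X) (eo_ob Y) = sub_r X hH ⊠ sub_r Y hH.
Proof. by rewrite /sub_r -!lock; exact: eqv_tens_rE X Y (Subg hH). Qed.

Lemma sub_r_unit (h : gT) (hH : h \in H) :
  sub_r (munit : CH) hH ∘ mf_eps (act h) = mid munit.
Proof. by rewrite /sub_r -lock; exact: iso_homK (mf_eps (act h)). Qed.

(* On an H-equivariant object X the objects rho(g)(X), for g in a fixed left
   coset of H, are canonically isomorphic. *)
Definition swap (X : CH) (g g' : gT) (w : (g'^-1 * g)%g \in H) :
    iso (act g (eo_ob X)) (act g' (eo_ob X)) :=
  locked (iso_comp (fun_iso (act g') (sub_r X w))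
    (iso_sym (act_mul (mulKVg g' g) (eo_ob X)))).

Lemma swap_irr (X : CH) (g g' : gT) (w w' : (g'^-1 * g)%g \in H) : swap X w = swap X w'.
Proof. by congr swap; exact: bool_irrelevance. Qed.

(** As [act_mul] is invertible, this equation characterizes [swap]; identities between swaps can be
    checked after composition with [act_mul]. *)
Lemma swapE (X : CH) (g g' h : gT) (w : (g'^-1 * g)%g \in H) (e : (g' * h)%g = g)
    (hH : h \in H) :
  swap X w ∘ act_mul e (eo_ob X) = fun_hom (act g') (sub_r X hH).
Proof.
have hE : h = (g'^-1 * g)%g by rewrite -e mulKg.
subst h; rewrite /swap -lock /=.
rewrite (eq_irrelevance e (mulKVg g' g)) -mcompA iso_homK mcompf1.
by rewrite (bool_irrelevance w hH).
Qed.

Lemma swap_id (X : CH) (g : gT) (w : (g^-1 * g)%g \in H) : swap X w = mid _ :> Hom _ _.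
Proof.
apply: (iso_cancel_r (i := act_mul (mulg1 g) (eo_ob X))).
rewrite (swapE _ w _ (group1 H)) mcomp1f.
apply: (iso_cancel_r (i := fun_iso (act g) (act_one (eo_ob X)))).
by rewrite /= act_mulr1 -fun_comp sub_r_one fun_id.
Qed.

(** The cocycle property: with g' = g''h' and g = g'h, it is the multiplicativity of the H-structure
    at h' and h, carried through the associativity of rho. *)
Lemma swap_comp (X : CH) (g g' g'' : gT) (w' : (g''^-1 * g')%g \in H)
    (w : (g'^-1 * g)%g \in H) (w'' : (g''^-1 * g)%g \in H) :
  swap X w' ∘ swap X w = swap X w''.
Proof.
apply: (iso_cancel_r (i := act_mul (mulKVg g' g) (eo_ob X))).
rewrite -mcompA (swapE _ w _ w).
apply: (iso_cancel_r (i := act_mul (mulKVg g'' g') (act (g'^-1 * g)%g (eo_ob X)))).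
rewrite -mcompA -act_mul_nat mcompA (swapE _ w' _ w') -fun_comp.
have e : ((g''^-1 * g') * (g'^-1 * g) = g''^-1 * g)%g by rewrite !mulgA mulgK.
rewrite (sub_r_mul X e w' w w'') fun_comp -(swapE _ w'' (mulKVg g'' g)).
by rewrite -!mcompA (act_mulA _ _ _ e (mulKVg g'' g)).
Qed.

Lemma swap_nat (X Y : CH) (f : Hom X Y) (g g' : gT) (w : (g'^-1 * g)%g \in H) :
  swap Y w ∘ fun_hom (act g) (eh_hom f) = fun_hom (act g') (eh_hom f) ∘ swap X w.
Proof.
apply: (iso_cancel_r (i := act_mul (mulKVg g' g) (eo_ob X))).
rewrite -[RHS]mcompA (swapE _ w _ w) -mcompA -act_mul_nat mcompA (swapE _ w _ w).
by rewrite -!fun_comp sub_r_hom.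
Qed.

Lemma swap_tens (X Y : CH) (g g' : gT) (w : (g'^-1 * g)%g \in H) :
  swap (X ⊗ Y) w ∘ mf_mu (act g) (eo_ob X) (eo_ob Y) =
  mf_mu (act g') (eo_ob X) (eo_ob Y) ∘ (swap X w ⊠ swap Y w).
Proof.
pose e := mulKVg g' g.
apply: (iso_cancel_r (i := thom_iso (act_mul e (eo_ob X)) (act_mul e (eo_ob Y)))).
rewrite -[LHS]mcompA -act_mul_tens -[RHS]mcompA -thom_comp !(swapE _ w _ w).
have eXY : swap (X ⊗ Y) w ∘ act_mul e (eo_ob X ⊗ eo_ob Y) = _ := swapE (X ⊗ Y) w e w.
rewrite [LHS]mcompA eXY mf_mu_nat mcompA -fun_comp.
by rewrite sub_r_tens.
Qed.

Lemma swap_unit (g g' : gT) (w : (g'^-1 * g)%g \in H) :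
  swap munit w ∘ mf_eps (act g) = mf_eps (act g').
Proof.
pose e := mulKVg g' g.
have e1 : swap munit w ∘ act_mul e munit = _ := swapE munit w e w.
rewrite -(act_mul_unit _ e) [LHS]mcompA e1 mcompA -fun_comp.
by rewrite sub_r_unit fun_id mcomp1f.
Qed.

(** Left translation by [a] leaves g'^-1 g unchanged, so both swaps are built from the same
    structure map of X and only associativity of rho remains. *)
Lemma act_swap (X : CH) (a g g' b b' : gT) (e : (a * g)%g = b) (e' : (a * g')%g = b')
    (w : (g'^-1 * g)%g \in H) (v : (b'^-1 * b)%g \in H) :
  act_mul e' (eo_ob X) ∘ fun_hom (act a) (swap X w) =
  swap X v ∘ act_mul e (eo_ob X).
Proof.
apply: (iso_cancel_r (i := fun_iso (act a) (act_mul (mulKVg g' g) (eo_ob X)))).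
rewrite -[LHS]mcompA -fun_comp (swapE _ w _ w) act_mul_nat.
have eb : (b' * (g'^-1 * g) = b)%g by rewrite -e -e' -mulgA mulKVg.
by rewrite -(swapE _ v eb w) -[RHS]mcompA -[LHS]mcompA (act_mulA _ _ _ (mulKVg g' g) e).
Qed.

End Swap.

Lemma reassoc (C : category) (X Y Y' Z : C) (h : Hom Y Z) (g : Hom X Y)
    (h' : Hom Y' Z) (g' : Hom X Y') (e : h ∘ g = h' ∘ g') (W : C) (u : Hom W X) :
  h ∘ (g ∘ u) = h' ∘ (g' ∘ u).
Proof. by rewrite !mcompA e. Qed.

Lemma iso_family_natural (C D : category) (F G : functor C D)
    (e : forall X, iso (F X) (G X)) :
  (forall (X Y : C) (f : Hom X Y), e Y ∘ fun_hom F f = fun_hom G f ∘ e X) ->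
  naturally_isomorphic F G.
Proof. by move=> en; exists (NatTrans en) => X; exists (e X). Qed.

(** * Twisting an H-equivariant object by an element of G *)

Section Twist.
Variables (gT : finGroupType) (k : fieldType) (C : lin_moncat k).
Variables (rho : tensor_action gT C) (H : {group gT}).
Hypothesis nH : (H <| [set: gT])%g.
Local Notation act := (act_functor rho).
Local Notation act_mul := (act_mul rho).
Local Notation CH := (equivariantization (restrict_action rho H)).

Lemma norm_setT (g : gT) : (g \in 'N(H))%g.
Proof. exact: subsetP (normal_norm nH) g (in_setT g). Qed.

(** This is where normality acts: g^-1 (hg) is the conjugate of h by g, so left multiplication by H
    preserves left cosets. *)
Lemma same_coset_conj (g h l : gT) : (h * g)%g = l -> h \in H -> (g^-1 * l)%g \in H.
Proof. by move=> <- hH; rewrite -/(conjg h g) memJ_norm // norm_setT. Qed.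

Lemma same_coset_mulr (a a' b b' g : gT) : (a * g)%g = b -> (a' * g)%g = b' ->
  (a'^-1 * a)%g \in H -> (b'^-1 * b)%g \in H.
Proof.
by move=> <- <- aH; rewrite invMg -mulgA (mulgA a'^-1%g) (@same_coset_conj g _ _ erefl).
Qed.

Lemma same_coset_mull (a g g' b b' : gT) : (a * g)%g = b -> (a * g')%g = b' ->
  (g'^-1 * g)%g \in H -> (b'^-1 * b)%g \in H.
Proof. by move=> <- <-; rewrite invMg -mulgA mulKg. Qed.

(** The conjugated structure: since hg = g(h ^ g), the map is rho(h)rho(g)X -> rho(g)rho(h ^ g)X ->
    rho(g)X, the last arrow being rho(g) applied to the structure map of X at h ^ g. *)
Definition twist_r (g : gT) (X : CH) (h : subg_of H) :
    iso (act (sgval h) (act g (eo_ob X))) (act g (eo_ob X)) :=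
  iso_comp (swap X (same_coset_conj erefl (subgP h))) (act_mul erefl (eo_ob X)).

Lemma twist_rE (g : gT) (X : CH) (h : subg_of H) (l : gT) (e : (sgval h * g)%g = l)
    (w : (g^-1 * l)%g \in H) :
  twist_r g X h = swap X w ∘ act_mul e (eo_ob X) :> Hom _ _.
Proof. by subst l; rewrite /= (swap_irr X (same_coset_conj erefl (subgP h)) w). Qed.

Program Definition twist_ob (g : gT) (X : CH) : CH :=
  @EqObject _ k C (restrict_action rho H) (act g (eo_ob X)) (twist_r g X) _ _.
Next Obligation.
move=> g X h h'.
pose e : (sgval h * sgval h')%g = sgval (h * h')%g := erefl.
rewrite (restrict_act_mu rho e).
pose eg := mulgA (sgval h) (sgval h') g.
have w1 := same_coset_conj (erefl (sgval h * g)%g) (subgP h).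
have w2 := same_coset_conj (erefl (sgval h' * g)%g) (subgP h').
have w3 := same_coset_conj (erefl (sgval (h * h')%g * g)%g) (subgP (h * h')%g).
have w4 := same_coset_mull eg (erefl (sgval h * g)%g) w2.
rewrite (twist_rE X erefl w1) (twist_rE X erefl w2) (twist_rE X erefl w3).
rewrite fun_comp.
rewrite -[RHS]mcompA (act_mulA rho e erefl erefl eg) -[LHS]mcompA.
by rewrite (reassoc (act_swap X eg erefl w2 w4)) [LHS]mcompA (swap_comp X w1 w4 w3).
Qed.
Next Obligation.
move=> g X.
rewrite restrict_act_eps.
have w := same_coset_conj (mul1g g) (group1 H).
rewrite (@twist_rE g X (1%g : subg_of H) g (mul1g g) w).
by rewrite -mcompA act_mul1 mcompf1 swap_id.
Qed.

Lemma twist_sub_r (g : gT) (X : CH) (h l : gT) (e : (h * g)%g = l) (hH : h \in H)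
    (w : (g^-1 * l)%g \in H) :
  sub_r (twist_ob g X) hH = swap X w ∘ act_mul e (eo_ob X) :> Hom _ _.
Proof. by rewrite /sub_r -lock; exact: (@twist_rE g X (Subg hH) l e w). Qed.

(** Counterpart of [act_swap] for right translation. Multiplying by g on the right conjugates a'^-1
    a by g, which is the conjugation built into the structure of [twist_ob g X]. *)
Lemma twist_swap (g : gT) (X : CH) (a a' b b' : gT) (e : (a * g)%g = b)
    (e' : (a' * g)%g = b') (w : (a'^-1 * a)%g \in H) (v : (b'^-1 * b)%g \in H) :
  act_mul e' (eo_ob X) ∘ swap (twist_ob g X) w = swap X v ∘ act_mul e (eo_ob X).
Proof.
pose ew := mulVKg a' a.
apply: (iso_cancel_r (i := act_mul ew (act g (eo_ob X)))).
have eT : swap (twist_ob g X) w ∘ act_mul ew (act g (eo_ob X)) = _ :=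
  swapE (twist_ob g X) w ew w.
rewrite -[LHS]mcompA eT.
have u := same_coset_conj (erefl ((a'^-1 * a) * g)%g) w.
have eb : (a' * ((a'^-1 * a) * g))%g = b by rewrite mulgA mulVKg.
rewrite (twist_sub_r X erefl w u) fun_comp [LHS]mcompA (act_swap X eb e' u v).
by rewrite -[LHS]mcompA -[RHS]mcompA (act_mulA rho ew e erefl eb).
Qed.

Program Definition twist_hom (g : gT) (X Y : CH) (f : Hom X Y) :
    Hom (twist_ob g X) (twist_ob g Y) :=
  @EqHom _ k C (restrict_action rho H) (twist_ob g X) (twist_ob g Y)
    (fun_hom (act g) (eh_hom f)) _.
Next Obligation.
move=> g X Y f; apply/forallP => h; apply/eqP.
have w := same_coset_conj (erefl (sgval h * g)%g) (subgP h).
apply: etrans (congr1 (fun u => _ ∘ u) (twist_rE X erefl w)) _.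
apply: etrans _ (congr1 (fun u => u ∘ _) (esym (twist_rE Y erefl w))).
by rewrite -[RHS]mcompA [in RHS]act_mul_nat !mcompA swap_nat.
Qed.

Program Definition twist_mu (g : gT) (X Y : CH) :
    iso (twist_ob g X ⊗ twist_ob g Y) (twist_ob g (X ⊗ Y)) :=
  @eqv_iso _ k C (restrict_action rho H)
    (twist_ob g X ⊗ twist_ob g Y) (twist_ob g (X ⊗ Y))
    (mf_mu (act g) (eo_ob X) (eo_ob Y)) _.
Next Obligation.
move=> g X Y h.
have w := same_coset_conj (erefl (sgval h * g)%g) (subgP h).
apply: etrans _ (congr1 (fun u => u ∘ _) (esym (twist_rE (X ⊗ Y) erefl w))).
apply: (iso_cancel_r (i := mf_mu (act (sgval h)) (act g (eo_ob X)) (act g (eo_ob Y)))).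
rewrite -[LHS]mcompA.
have -> : eo_r (twist_ob g X ⊗ twist_ob g Y) h ∘
  mf_mu (act (sgval h)) (act g (eo_ob X)) (act g (eo_ob Y)) = _ :=
  eqv_tens_rE (twist_ob g X) (twist_ob g Y) h.
rewrite -[RHS]mcompA -[RHS]mcompA act_mul_tens [RHS]mcompA swap_tens.
by rewrite -[RHS]mcompA -thom_comp -!twist_rE.
Qed.

Program Definition twist_eps (g : gT) : @iso CH munit (twist_ob g munit) :=
  @eqv_iso _ k C (restrict_action rho H) (eqv_unit _) (twist_ob g munit)
    (mf_eps (act g)) _.
Next Obligation.
move=> g h.
have w := same_coset_conj (erefl (sgval h * g)%g) (subgP h).
apply: etrans _ (congr1 (fun u => u ∘ _) (esym (twist_rE munit erefl w))).
apply: (iso_cancel_r (i := mf_eps (act (sgval h)))).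
rewrite -[LHS]mcompA.
have -> : eo_r (eqv_unit (restrict_action rho H)) h ∘ mf_eps (act (sgval h)) = mid munit
  := iso_homK (mf_eps (act (sgval h))).
by rewrite -[RHS]mcompA -[RHS]mcompA act_mul_unit swap_unit mcompf1.
Qed.

Program Definition twist (g : gT) : tensor_functor CH CH :=
  @TensorFunctor k _ _
    (@MonFunctor _ _ (@Functor CH CH (twist_ob g) (twist_hom g) _ _)
       (twist_mu g) (twist_eps g) _ _ _ _) _.
Next Obligation. by move=> *; apply: eqv_hom_inj; exact: fun_id. Qed.
Next Obligation. by move=> *; apply: eqv_hom_inj; exact: fun_comp. Qed.
Next Obligation. by move=> *; apply: eqv_hom_inj; exact: mf_mu_nat. Qed.
Next Obligation. by move=> *; apply: eqv_hom_inj; exact: mf_assoc. Qed.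
Next Obligation. by move=> *; apply: eqv_hom_inj; exact: mf_lunit. Qed.
Next Obligation. by move=> *; apply: eqv_hom_inj; exact: mf_runit. Qed.
Next Obligation. by move=> *; apply: eqv_hom_inj; exact: tf_lin. Qed.

End Twist.

Lemma square_paste (C : category) (X X' Y Y' Z Z' : C) (f : Hom X X') (f' : Hom Y Y')
    (f'' : Hom Z Z') (b : Hom X' Y') (b' : Hom X Y) (a : Hom Y' Z') (a' : Hom Y Z) :
  b ∘ f = f' ∘ b' -> a ∘ f' = f'' ∘ a' -> (a ∘ b) ∘ f = f'' ∘ (a' ∘ b').
Proof. by move=> e e'; rewrite -mcompA e mcompA e' -mcompA. Qed.

Lemma square_paste_tens (C : moncat) (W W' X X' Y Y' V V' Z : C)
    (m : Hom (X ⊗ X') W) (m' : Hom (Y ⊗ Y') W') (m'' : Hom (V ⊗ V') Z)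
    (b : Hom W W') (b1 : Hom X Y) (b2 : Hom X' Y')
    (a : Hom W' Z) (a1 : Hom Y V) (a2 : Hom Y' V') :
  b ∘ m = m' ∘ (b1 ⊠ b2) -> a ∘ m' = m'' ∘ (a1 ⊠ a2) ->
  (a ∘ b) ∘ m = m'' ∘ ((a1 ∘ b1) ⊠ (a2 ∘ b2)).
Proof. by move=> e e'; rewrite thom_comp; exact: square_paste e e'. Qed.

Lemma iso_cospan_natural (C D : category) (F G H : functor C D)
    (a : forall X, iso (F X) (H X)) (b : forall X, iso (G X) (H X)) :
  (forall (X Y : C) (f : Hom X Y), a Y ∘ fun_hom F f = fun_hom H f ∘ a X) ->
  (forall (X Y : C) (f : Hom X Y), b Y ∘ fun_hom G f = fun_hom H f ∘ b X) ->
  naturally_isomorphic F G.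
Proof.
move=> an bn.
apply: (@iso_family_natural _ _ _ _ (fun X => iso_comp (iso_sym (b X)) (a X))) => X Y f.
apply: (iso_cancel_l (i := b Y)); rewrite [RHS]mcompA bn /=.
by rewrite -!mcompA !(mcompA (b _) (iso_inv _)) !iso_invK !mcomp1f an.
Qed.

Section QuotientAction.
Variables (gT : finGroupType) (k : fieldType) (C : lin_moncat k).
Variables (rho : tensor_action gT C) (H : {group gT}).
Hypothesis nH : (H <| [set: gT])%g.
Local Notation act_mul := (act_mul rho).
Local Notation act_one := (act_one rho).
Local Notation CH := (equivariantization (restrict_action rho H)).
Local Notation twist := (@twist _ _ _ rho H nH).
Local Notation twist_ob := (twist_ob nH).

Program Definition swap_iso (g g' : gT) (w : (g'^-1 * g)%g \in H) (X : CH) :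
    @iso CH (twist_ob g X) (twist_ob g' X) :=
  @eqv_iso _ k C (restrict_action rho H) (twist_ob g X) (twist_ob g' X) (swap X w) _.
Next Obligation.
move=> g g' w X h.
have w1 := same_coset_conj nH (erefl (sgval h * g)%g) (subgP h).
have w2 := same_coset_conj nH (erefl (sgval h * g')%g) (subgP h).
have w3 := same_coset_mull (erefl (sgval h * g)%g) (erefl (sgval h * g')%g) w.
have w4 : (g'^-1 * (sgval h * g))%g \in H.
  have -> : (g'^-1 * (sgval h * g) = (g'^-1 * (sgval h * g')) * (g'^-1 * g))%g.
    by rewrite -!mulgA mulKVg.
  exact: groupM.
apply: etrans (congr1 (fun u => _ ∘ u) (twist_rE nH X erefl w1)) _.
apply: etrans _ (congr1 (fun u => u ∘ _) (esym (twist_rE nH X erefl w2))).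
rewrite [LHS]mcompA (swap_comp X w w1 w4) -[RHS]mcompA (act_swap X erefl erefl w w3).
by rewrite [RHS]mcompA (swap_comp X w2 w3 w4).
Qed.

Program Definition twist_mul (g h : gT) (X : CH) :
    @iso CH (twist_ob g (twist_ob h X)) (twist_ob (g * h)%g X) :=
  @eqv_iso _ k C (restrict_action rho H) (twist_ob g (twist_ob h X))
    (twist_ob (g * h)%g X) (act_mul erefl (eo_ob X)) _.
Next Obligation.
move=> g g' X h.
have w1 := same_coset_conj nH (erefl (sgval h * g)%g) (subgP h).
have w2 := same_coset_conj nH (mulgA (sgval h) g g') (subgP h).
apply: etrans (congr1 (fun u => _ ∘ u) (twist_rE nH (twist_ob g' X) erefl w1)) _.
apply: etrans _ (congr1 (fun u => u ∘ _) (esym (twist_rE nH X (mulgA _ _ _) w2))).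
rewrite [LHS]mcompA (twist_swap nH X erefl erefl w1 w2) -[LHS]mcompA -[RHS]mcompA.
by rewrite (act_mulA rho erefl erefl erefl (mulgA (sgval h) g g')).
Qed.

Program Definition twist_one (X : CH) : @iso CH X (twist_ob 1%g X) :=
  @eqv_iso _ k C (restrict_action rho H) X (twist_ob 1%g X) (act_one (eo_ob X)) _.
Next Obligation.
move=> X h.
have w : (1^-1 * sgval h)%g \in H by rewrite invg1 mul1g subgP.
apply: etrans _ (congr1 (fun u => u ∘ _) (esym (twist_rE nH X (mulg1 _) w))).
apply: etrans _ (mcompA _ _ _).
apply: etrans _ (congr1 (fun u => swap X w ∘ u)
  (esym (act_mulr1 rho (mulg1 (sgval h)) (eo_ob X)))).
rewrite mcompf1 eo_r_sub act_one_nat.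
rewrite -(swapE X w (mul1g _)) -mcompA.
apply: etrans (mcompf1 _); congr (_ ∘ _).
exact: (act_mul1 rho (mul1g (sgval h)) (eo_ob X)).
Qed.

(** The target is any [l] in the coset of [g * h], because the product of two representatives is in
    general not the chosen representative of the product. *)
Definition twist_mul_swap (g h l : gT) (w : (l^-1 * (g * h))%g \in H) (X : CH) :
    @iso CH (twist_ob g (twist_ob h X)) (twist_ob l X) :=
  iso_comp (swap_iso w X) (twist_mul g h X).

Definition twist_one_swap (g : gT) (w : (g^-1 * 1)%g \in H) (X : CH) :
    @iso CH X (twist_ob g X) :=
  iso_comp (swap_iso w X) (twist_one X).

Lemma swap_iso_nat (g h : gT) (w : (h^-1 * g)%g \in H) (X Y : CH) (f : Hom X Y) :
  swap_iso w Y ∘ fun_hom (twist g) f = fun_hom (twist h) f ∘ swap_iso w X.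
Proof. by apply: eqv_hom_inj; exact: swap_nat. Qed.

Lemma swap_iso_mu (g h : gT) (w : (h^-1 * g)%g \in H) (X Y : CH) :
  swap_iso w (X ⊗ Y) ∘ mf_mu (twist g) X Y =
  mf_mu (twist h) X Y ∘ (swap_iso w X ⊠ swap_iso w Y).
Proof. by apply: eqv_hom_inj; exact: swap_tens. Qed.

Lemma swap_iso_eps (g h : gT) (w : (h^-1 * g)%g \in H) :
  swap_iso w munit ∘ mf_eps (twist g) = mf_eps (twist h).
Proof. by apply: eqv_hom_inj; exact: swap_unit. Qed.

Lemma twist_mul_swap_nat (g h l : gT) (w : (l^-1 * (g * h))%g \in H) (X Y : CH) (f : Hom X Y) :
  twist_mul_swap w Y ∘ fun_hom (functor_comp (twist g) (twist h)) f =
  fun_hom (twist l) f ∘ twist_mul_swap w X.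
Proof.
have e : twist_mul g h Y ∘ fun_hom (twist g) (fun_hom (twist h) f) =
    fun_hom (twist (g * h)%g) f ∘ twist_mul g h X.
  by apply: eqv_hom_inj; exact: act_mul_nat.
exact: square_paste e (swap_iso_nat w f).
Qed.

Lemma twist_mul_swap_mu (g h l : gT) (w : (l^-1 * (g * h))%g \in H) (X Y : CH) :
  twist_mul_swap w (X ⊗ Y) ∘ mf_mu (mon_functor_comp (twist g) (twist h)) X Y =
  mf_mu (twist l) X Y ∘ (twist_mul_swap w X ⊠ twist_mul_swap w Y).
Proof.
have e : twist_mul g h (X ⊗ Y) ∘ mf_mu (mon_functor_comp (twist g) (twist h)) X Y =
    mf_mu (twist (g * h)%g) X Y ∘ (twist_mul g h X ⊠ twist_mul g h Y).
  by apply: eqv_hom_inj; exact: act_mul_tens.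
exact: square_paste_tens e (swap_iso_mu w X Y).
Qed.

Lemma twist_mul_swap_eps (g h l : gT) (w : (l^-1 * (g * h))%g \in H) :
  twist_mul_swap w munit ∘ mf_eps (mon_functor_comp (twist g) (twist h)) =
  mf_eps (twist l).
Proof.
have e : twist_mul g h munit ∘ mf_eps (mon_functor_comp (twist g) (twist h)) =
    mf_eps (twist (g * h)%g).
  by apply: eqv_hom_inj; exact: act_mul_unit.
by apply: etrans (esym (mcompA _ _ _)) _; rewrite e; exact: swap_iso_eps.
Qed.

Lemma twist_one_swap_nat (g : gT) (w : (g^-1 * 1)%g \in H) (X Y : CH) (f : Hom X Y) :
  twist_one_swap w Y ∘ f = fun_hom (twist g) f ∘ twist_one_swap w X.
Proof.
have e : twist_one Y ∘ f = fun_hom (twist 1%g) f ∘ twist_one X.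
  by apply: eqv_hom_inj; exact: act_one_nat.
exact: square_paste e (swap_iso_nat w f).
Qed.

Lemma twist_one_swap_mu (g : gT) (w : (g^-1 * 1)%g \in H) (X Y : CH) :
  twist_one_swap w (X ⊗ Y) ∘ mid (X ⊗ Y) =
  mf_mu (twist g) X Y ∘ (twist_one_swap w X ⊠ twist_one_swap w Y).
Proof.
have e : twist_one (X ⊗ Y) ∘ mid (X ⊗ Y) =
   mf_mu (twist 1%g) X Y ∘ (twist_one X ⊠ twist_one Y) :> Hom _ _.
  by rewrite mcompf1; apply: eqv_hom_inj; exact: act_one_tens.
exact: square_paste_tens e (swap_iso_mu w X Y).
Qed.

Lemma twist_one_swap_eps (g : gT) (w : (g^-1 * 1)%g \in H) :
  twist_one_swap w munit ∘ mid munit = mf_eps (twist g).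
Proof.
have e : twist_one munit ∘ mid munit = mf_eps (twist 1%g) :> Hom _ _.
  by rewrite mcompf1; apply: eqv_hom_inj; exact: act_one_unit.
by apply: etrans (esym (mcompA _ _ _)) _; rewrite e; exact: swap_iso_eps.
Qed.

Lemma twist_inverse (g h : gT) : (g * h = 1)%g ->
  naturally_isomorphic (functor_comp (twist g) (twist h)) (functor_id CH).
Proof.
move=> gh.
have w : (1^-1 * (g * h))%g \in H by rewrite gh invg1 mulg1 group1.
have w1 : (1^-1 * 1)%g \in H by rewrite mulVg group1.
exact: (@iso_cospan_natural CH CH (functor_comp (twist g) (twist h)) (functor_id CH)
  (twist 1%g) (twist_mul_swap w) (twist_one_swap w1)
  (@twist_mul_swap_nat g h 1%g w) (@twist_one_swap_nat 1%g w1)).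
Qed.

End QuotientAction.

(** * The action of G/H through coset representatives *)

Section Sigma.
Variables (gT : finGroupType) (k : fieldType) (C : lin_moncat k).
Variables (rho : tensor_action gT C) (H : {group gT}).
Hypothesis nH : (H <| [set: gT])%g.
Local Notation CH := (equivariantization (restrict_action rho H)).
Local Notation twist := (@twist _ _ _ rho H nH).

Lemma twist_equivalence (g : gT) : is_equivalence (twist g).
Proof.
by exists (twist g^-1%g); split; apply: twist_inverse; rewrite ?mulgV ?mulVg.
Qed.

Lemma coset_mul (g h : gT) : coset H (g * h)%g = (coset H g * coset H h)%g.
Proof. by apply: coset_morphM; exact: (norm_setT nH). Qed.

Lemma same_coset (g g' : gT) : coset H g = coset H g' -> (g'^-1 * g)%g \in H.
Proof.
move=> e; apply: coset_idr; first exact: (norm_setT nH).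
by apply: (mulgI (coset H g')); rewrite -coset_mul mulKVg mulg1.
Qed.

Definition rep (q : coset_of H) : gT := repr q.

Lemma coset_rep (q : coset_of H) : coset H (rep q) = q.
Proof. exact: coset_reprK. Qed.

Lemma same_rep (g : gT) (q : coset_of H) : coset H g = q -> ((rep q)^-1 * g)%g \in H.
Proof. by move=> e; apply: same_coset; rewrite coset_rep. Qed.

Lemma same_rep_mul (q q' : coset_of H) :
  ((rep (q * q')%g)^-1 * (rep q * rep q'))%g \in H.
Proof. by apply: same_rep; rewrite coset_mul !coset_rep. Qed.

Lemma same_rep_one : ((rep 1%g)^-1 * 1)%g \in H.
Proof. by apply: same_rep; exact: coset_id (group1 H). Qed.

Lemma same_rep_eq (q q' : coset_of H) : q = q' -> ((rep q')^-1 * rep q)%g \in H.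
Proof. by move=> <-; rewrite mulVg group1. Qed.

Definition sigma_ob (q : coset_of H) : aut_tensor CH :=
  @AutoEquivalence k CH (twist (rep q)) (twist_equivalence (rep q)).

(** An equality of cosets acts by a swap instead of a transport, so that it merges with the
    neighbouring swaps by [swap_comp]. *)
Definition sigma_hom (q q' : disc (coset_of H)) (e : Hom q q') :
    Hom (sigma_ob q) (sigma_ob q') :=
  iso_hom (@aut_iso k CH (sigma_ob q) (sigma_ob q')
    (swap_iso nH (same_rep_eq e)) (@swap_iso_nat _ _ _ _ _ nH _ _ _)
    (@swap_iso_mu _ _ _ _ _ nH _ _ _) (@swap_iso_eps _ _ _ _ _ nH _ _ _)).

Definition sigma_mu (q q' : disc (coset_of H)) :
    iso (aut_tens (sigma_ob q) (sigma_ob q')) (sigma_ob (q * q')%g) :=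
  @aut_iso k CH (aut_tens (sigma_ob q) (sigma_ob q')) (sigma_ob (q * q')%g)
    (twist_mul_swap nH (same_rep_mul q q')) (@twist_mul_swap_nat _ _ _ _ _ nH _ _ _ _)
    (@twist_mul_swap_mu _ _ _ _ _ nH _ _ _ _)
    (@twist_mul_swap_eps _ _ _ _ _ nH _ _ _ _).

Definition sigma_eps : iso (aut_unit CH) (sigma_ob 1%g) :=
  @aut_iso k CH (aut_unit CH) (sigma_ob 1%g)
    (twist_one_swap nH same_rep_one) (@twist_one_swap_nat _ _ _ _ _ nH _ _)
    (@twist_one_swap_mu _ _ _ _ _ nH _ _)
    (@twist_one_swap_eps _ _ _ _ _ nH _ _).

Program Definition sigma : tensor_action (coset_of H) CH :=
  @MonFunctor (disc (coset_of H)) (aut_tensor CH)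
    (@Functor (disc (coset_of H)) (aut_tensor CH) sigma_ob sigma_hom _ _)
    sigma_mu sigma_eps _ _ _ _.
Next Obligation.
by move=> q; apply: mon_nat_trans_eq => X; apply: eqv_hom_inj; exact: swap_id.
Qed.
Next Obligation.
move=> q q' q'' e e'; apply: mon_nat_trans_eq => X; apply: eqv_hom_inj.
by apply: esym; exact: swap_comp.
Qed.
Next Obligation.
move=> q q' l l' e f; case: q' / e; case: l' / f.
apply: mon_nat_trans_eq => X; apply: eqv_hom_inj.
by rewrite /= !swap_id fun_id !mcompf1 mcomp1f.
Qed.
Next Obligation.
move=> q q' q''; apply: mon_nat_trans_eq => X; apply: eqv_hom_inj.
rewrite /= !fun_id !mcompf1 mcomp1f fun_comp.
(* Both paths are routed through rho(b): [e1] and [e2] move the inner swaps past the constraints,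
   associativity identifies the two maps to rho(b), and the remaining swaps out of rho(b) agree by
   the cocycle property. *)
pose b := (rep q * rep q' * rep q'')%g.
have w1 : ((rep (q * q')%g * rep q'')^-1 * b)%g \in H :=
  same_coset_mulr nH erefl erefl (same_rep_mul q q').
have w2 : ((rep q * rep (q' * q'')%g)^-1 * b)%g \in H :=
  same_coset_mull (mulgA _ _ _) erefl (same_rep_mul q' q'').
have w3 : ((rep (q * q' * q'')%g)^-1 * b)%g \in H.
  by apply: same_rep; rewrite !coset_mul !coset_rep.
have w4 : ((rep (q * (q' * q''))%g)^-1 * b)%g \in H.
  by apply: same_rep; rewrite !coset_mul !coset_rep mulgA.
have e1 := twist_swap nH X (erefl b) (erefl (rep (q * q')%g * rep q'')%g)
  (same_rep_mul q q') w1.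
have e2 := act_swap X (mulgA (rep q) (rep q') (rep q''))
  (erefl (rep q * rep (q' * q'')%g)%g) (same_rep_mul q' q'') w2.
rewrite -!mcompA (reassoc e1) (reassoc e2).
rewrite (act_mulA rho erefl erefl erefl (mulgA (rep q) (rep q') (rep q''))).
rewrite 2![LHS]mcompA [RHS]mcompA -[X in X ∘ _]mcompA.
by rewrite (swap_comp X (same_rep_mul (q * q')%g q'') w1 w3) (swap_comp X _ w3 w4)
  (swap_comp X (same_rep_mul q (q' * q'')%g) w2 w4).
Qed.
Next Obligation.
move=> q; apply: mon_nat_trans_eq => X; apply: eqv_hom_inj.
rewrite /= mcompf1.
have w1 : ((rep 1%g * rep q)^-1 * rep q)%g \in H :=
  same_coset_mulr nH (mul1g _) erefl same_rep_one.
have w2 : ((rep (1 * q)%g)^-1 * rep q)%g \in H by rewrite mul1g mulVg.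
have e1 := twist_swap nH X (mul1g (rep q)) (erefl (rep 1%g * rep q)%g) same_rep_one w1.
rewrite -!mcompA (reassoc e1) act_mul1 mcompf1.
rewrite (swap_comp X (same_rep_mul 1%g q) w1 w2) (swap_comp X _ w2 (same_rep_eq erefl)).
exact: swap_id.
Qed.
Next Obligation.
move=> q; apply: mon_nat_trans_eq => X; apply: eqv_hom_inj.
rewrite /= mcomp1f fun_comp.
have w1 : ((rep q * rep 1%g)^-1 * rep q)%g \in H :=
  same_coset_mull (mulg1 _) erefl same_rep_one.
have w2 : ((rep (q * 1)%g)^-1 * rep q)%g \in H by rewrite mulg1 mulVg.
have e1 := act_swap X (mulg1 (rep q)) (erefl (rep q * rep 1%g)%g) same_rep_one w1.
rewrite -!mcompA (reassoc e1) act_mulr1 mcompf1.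
rewrite (swap_comp X (same_rep_mul q 1%g) w1 w2) (swap_comp X _ w2 (same_rep_eq erefl)).
exact: swap_id.
Qed.

End Sigma.

(** * Comparison of the equivariantizations *)

Lemma tensor_functor_eq (k : fieldType) (C D : lin_moncat k)
    (o : C -> D) (m : forall X Y, Hom X Y -> Hom (o X) (o Y)) i i' c c'
    (mu mu' : forall X Y : C, iso (o X ⊗ o Y) (o (X ⊗ Y))) (eps eps' : iso munit (o munit))
    n n' a a' l l' r r' ln ln' :
  (forall X Y, mu X Y = mu' X Y :> Hom _ _) -> eps = eps' :> Hom _ _ ->
  @TensorFunctor k C D (@MonFunctor C D (@Functor C D o m i c) mu eps n a l r) ln =
  @TensorFunctor k C D (@MonFunctor C D (@Functor C D o m i' c') mu' eps' n' a' l' r') ln'.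
Proof.
move=> emu /iso_eq eeps; have ei : i = i' by exact: Prop_irrelevance.
have ec : c = c' by exact: Prop_irrelevance.
have {}emu : mu = mu'.
  apply: functional_extensionality_dep => X; apply: functional_extensionality_dep => Y.
  exact: iso_eq.
subst i' c' mu' eps'.
rewrite (Prop_irrelevance n' n) (Prop_irrelevance a' a) (Prop_irrelevance l' l).
by rewrite (Prop_irrelevance r' r) (Prop_irrelevance ln' ln).
Qed.

Section Comparison.
Variables (gT : finGroupType) (k : fieldType) (C : lin_moncat k).
Variables (rho : tensor_action gT C) (H : {group gT}).
Hypothesis nH : (H <| [set: gT])%g.
Local Notation act := (act_functor rho).
Local Notation act_mul := (act_mul rho).
Local Notation act_one := (act_one rho).
Local Notation CG := (equivariantization rho).
Local Notation CH := (equivariantization (restrict_action rho H)).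
Local Notation twist_ob := (twist_ob nH).
Local Notation sigma := (sigma rho nH).
Local Notation res := (restriction_functor rho H).

Lemma restrict_sub_r (X : CG) (h : gT) (hH : h \in H) :
  sub_r (restrict_ob H X) hH = eo_r X h :> Hom _ _.
Proof. by rewrite /sub_r -lock. Qed.

(** When the H-structure comes from a G-structure, the swap is r_g'^-1 r_g. Hence one structure map
    per coset, together with the H-structure, determines all of them. *)
Lemma eo_r_swap (X : CG) (g g' : gT) (w : (g'^-1 * g)%g \in H) :
  eo_r X g' ∘ swap (restrict_ob H X) w = eo_r X g.
Proof.
pose e := mulKVg g' g.
apply: (iso_cancel_r (i := act_mul e (eo_ob X))).
rewrite -(eo_r_mul X e) -mcompA; congr (_ ∘ _).
by apply: etrans (swapE (restrict_ob H X) w e w) _; rewrite restrict_sub_r.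
Qed.

Program Definition comparison_r (X : CG) (q : coset_of H) :
    @iso CH (twist_ob (rep q) (restrict_ob H X)) (restrict_ob H X) :=
  @eqv_iso _ k C (restrict_action rho H) (twist_ob (rep q) (restrict_ob H X))
    (restrict_ob H X) (eo_r X (rep q)) _.
Next Obligation.
move=> X q h.
have w := same_coset_conj nH (erefl (sgval h * rep q)%g) (subgP h).
apply: etrans (congr1 (fun u => _ ∘ u) (twist_rE nH (restrict_ob H X) erefl w)) _.
by rewrite mcompA eo_r_swap -(eo_r_mul X erefl).
Qed.

Program Definition comparison_ob (X : CG) : equivariantization sigma :=
  @EqObject _ k CH sigma (restrict_ob H X) (comparison_r X) _ _.
Next Obligation.
move=> X q q'; apply: eqv_hom_inj.
apply: etrans (eo_r_mul X (erefl (rep q * rep q')%g)) _.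
by rewrite -(eo_r_swap X (same_rep_mul nH q q')) -mcompA.
Qed.
Next Obligation.
move=> X; apply: eqv_hom_inj.
apply: etrans (mcompA _ _ _) _; rewrite eo_r_swap.
by apply: etrans _ (eo_unit X); rewrite -act_oneE.
Qed.

Program Definition comparison_hom (X Y : CG) (f : Hom X Y) :
    Hom (comparison_ob X) (comparison_ob Y) :=
  @EqHom _ k CH sigma (comparison_ob X) (comparison_ob Y) (restrict_hom H f) _.
Next Obligation.
move=> X Y f; apply/forallP => q; apply/eqP; apply: eqv_hom_inj.
exact: eqv_homP f (rep q).
Qed.

Program Definition comparison_mu (X Y : CG) :
    iso (comparison_ob X ⊗ comparison_ob Y) (comparison_ob (X ⊗ Y)) :=
  @eqv_iso _ k CH sigma (comparison_ob X ⊗ comparison_ob Y) (comparison_ob (X ⊗ Y))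
    (restrict_mu H X Y) _.
Next Obligation.
move=> X Y q; apply: eqv_hom_inj.
by apply: etrans (mcomp1f _) _; rewrite [RHS]/= fun_id mcompf1.
Qed.

Program Definition comparison_eps :
    @iso (equivariantization sigma) munit (comparison_ob munit) :=
  @eqv_iso _ k CH sigma (eqv_unit _) (comparison_ob munit) (restrict_eps rho H) _.
Next Obligation.
move=> q; apply: eqv_hom_inj.
by apply: etrans (mcomp1f _) _; rewrite [RHS]/= fun_id mcompf1.
Qed.

Program Definition comparison : tensor_functor CG (equivariantization sigma) :=
  @TensorFunctor k _ _
    (@MonFunctor _ _
       (@Functor CG (equivariantization sigma) comparison_ob comparison_hom _ _)
       comparison_mu comparison_eps _ _ _ _) _.
Next Obligation. by move=> *; do 2!apply: eqv_hom_inj. Qed.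
Next Obligation. by move=> *; do 2!apply: eqv_hom_inj. Qed.
Next Obligation. by move=> *; do 2!apply: eqv_hom_inj; rewrite /= mcomp1f mcompf1. Qed.
Next Obligation.
by move=> *; do 2!apply: eqv_hom_inj; rewrite /= !thom_id !mcompf1 mcomp1f.
Qed.
Next Obligation. by move=> *; do 2!apply: eqv_hom_inj; rewrite /= !thom_id !mcompf1. Qed.
Next Obligation. by move=> *; do 2!apply: eqv_hom_inj; rewrite /= !thom_id !mcompf1. Qed.
Next Obligation. by move=> *; do 2!apply: eqv_hom_inj. Qed.

(** Objects and morphisms agree by conversion; the monoidal constraints of the composite differ from
    those of the restriction only by an identity factor. *)
Lemma forgetful_comparison :
  tensor_functor_comp (forgetful_functor sigma) comparison = res.
Proof.
apply: tensor_functor_eq => [X Y|]; apply: eqv_hom_inj; exact: mcompf1.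
Qed.

(** * Recovering the G-structure from the H-structure and the cosets *)

Section Inverse.
Variable Y : equivariantization sigma.
Local Notation X := (eo_ob Y).

(** The formula that [eo_r_swap] imposes: pass from g to the representative of its coset, then use
    the structure map of that coset. *)
Definition glue_r (g : gT) : iso (act g (eo_ob X)) (eo_ob X) :=
  iso_comp (fun_iso (forgetful_functor (restrict_action rho H)) (eo_r Y (coset H g)))
    (swap X (same_rep nH erefl)).

Lemma glue_rE (g : gT) (q : coset_of H) (e : coset H g = q)
    (w : ((rep q)^-1 * g)%g \in H) :
  glue_r g = eh_hom (iso_hom (eo_r Y q)) ∘ swap X w :> Hom _ _.
Proof. by subst q; rewrite /= (swap_irr X w (same_rep nH erefl)). Qed.

Program Definition glue_ob : CG := @EqObject gT k C rho (eo_ob X) glue_r _ _.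
Next Obligation.
move=> g h; set q := coset H g; set q' := coset H h.
have wg : ((rep q)^-1 * g)%g \in H by exact: same_rep.
have wh : ((rep q')^-1 * h)%g \in H by exact: same_rep.
have egh : coset H (g * h)%g = (q * q')%g by exact: coset_mul.
have wgh : ((rep (q * q')%g)^-1 * (g * h))%g \in H by exact: same_rep.
have w1 : ((rep q * rep q')^-1 * (g * rep q'))%g \in H :=
  same_coset_mulr nH erefl erefl wg.
have w2 : ((g * rep q')^-1 * (g * h))%g \in H := same_coset_mull erefl erefl wh.
have w3 : ((rep q * rep q')^-1 * (g * h))%g \in H.
  by apply: same_coset; rewrite // !coset_mul // !coset_rep.
rewrite (glue_rE erefl wg) (glue_rE erefl wh) (glue_rE egh wgh) fun_comp.
(* [e1] slides the swap past the second structure map, [e2] multiplies the two coset structure maps,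
   and [e3] and [e4] collect the swaps after the constraint of rho, where they compose to the one
   defining r_(gh). *)
have e1 : swap X wg ∘ fun_hom (act g) (eh_hom (iso_hom (eo_r Y q'))) =
  fun_hom (act (rep q)) (eh_hom (iso_hom (eo_r Y q'))) ∘ swap (twist_ob (rep q') X) wg
  := swap_nat (iso_hom (eo_r Y q')) wg.
have e2 : eh_hom (iso_hom (eo_r Y q)) ∘ fun_hom (act (rep q)) (eh_hom (iso_hom (eo_r Y q')))
  = eh_hom (iso_hom (eo_r Y (q * q')%g)) ∘ (swap X (same_rep_mul nH q q') ∘
      act_mul erefl (eo_ob X)) := congr1 (@eh_hom _ _ _ _ _ _) (eo_mul Y q q').
have e3 := twist_swap nH X (erefl (g * rep q')%g) (erefl (rep q * rep q')%g) wg w1.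
have e4 := act_swap X (erefl (g * h)%g) (erefl (g * rep q')%g) wh w2.
rewrite -[LHS]mcompA (reassoc e1) [LHS]mcompA e2 -!mcompA (reassoc e3) e4.
rewrite -act_mul_erefl; congr (_ ∘ _); rewrite !mcompA; congr (_ ∘ _).
by rewrite -mcompA (swap_comp X w1 w2 w3); exact: swap_comp.
Qed.
Next Obligation.
have w : ((rep (1%g : coset_of H))^-1 * 1)%g \in H by exact: same_rep_one.
rewrite (glue_rE (coset_id (group1 H)) w) -act_oneE -mcompA.
rewrite (swap_irr X w (same_rep_one nH)).
by have := congr1 (fun f : eqv_hom _ _ => eh_hom f) (eo_unit Y).
Qed.

Lemma glue_r_rep (q : coset_of H) : glue_r (rep q) = eh_hom (iso_hom (eo_r Y q)) :> Hom _ _.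
Proof. by rewrite (glue_rE (coset_rep q) (same_rep nH (coset_rep q))) swap_id mcompf1. Qed.

(** The unit axiom of Y makes the structure map of the trivial coset, preceded by the swap from 1
    and [act_one], the identity; what is left of the swap from h to the representative is the
    original structure map at h. *)
Lemma glue_r_sub (h : gT) (hH : h \in H) : glue_r h = sub_r X hH :> Hom _ _.
Proof.
have w1 : (1^-1 * h)%g \in H by rewrite invg1 mul1g.
have w : ((rep (1%g : coset_of H))^-1 * h)%g \in H.
  by apply: same_rep => //; exact: coset_id.
rewrite (glue_rE (coset_id hH) w) -(swap_comp X (same_rep_one nH) w1 w).
have s1 : swap X w1 = act_one (eo_ob X) ∘ sub_r X hH :> Hom _ _.
  rewrite act_one_nat -(swapE X w1 (mul1g h) hH) -mcompA.
  by rewrite act_mul1 mcompf1.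
rewrite s1 !mcompA -(mcompA (eh_hom _)); apply: etrans (mcomp1f _); congr (_ ∘ _).
by have := congr1 (fun f : eqv_hom _ _ => eh_hom f) (eo_unit Y).
Qed.

End Inverse.

Program Definition glue_hom (Y Z : equivariantization sigma) (f : Hom Y Z) :
    Hom (glue_ob Y) (glue_ob Z) :=
  @EqHom gT k C rho (glue_ob Y) (glue_ob Z) (eh_hom (eh_hom f)) _.
Next Obligation.
move=> Y Z f; apply/forallP => g; apply/eqP.
set q := coset H g; have w : ((rep q)^-1 * g)%g \in H by exact: same_rep.
have e : eh_hom (eh_hom f) ∘ eh_hom (iso_hom (eo_r Y q)) =
  eh_hom (iso_hom (eo_r Z q)) ∘ fun_hom (act (rep q)) (eh_hom (eh_hom f)) :=
  congr1 (@eh_hom _ _ _ _ _ _) (eqv_homP f q).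
apply: etrans (congr1 (fun u => _ ∘ u) (glue_rE Y erefl w)) _.
apply: etrans _ (congr1 (fun u => u ∘ _) (esym (glue_rE Z erefl w))).
by rewrite mcompA e -!mcompA -swap_nat.
Qed.

Program Definition glue : functor (equivariantization sigma) CG :=
  @Functor (equivariantization sigma) CG glue_ob glue_hom _ _.
Next Obligation. by move=> *; apply: eqv_hom_inj. Qed.
Next Obligation. by move=> *; apply: eqv_hom_inj. Qed.

Program Definition glue_comparison_iso (X : CG) : @iso CG (glue_ob (comparison_ob X)) X :=
  @eqv_iso gT k C rho (glue_ob (comparison_ob X)) X (iso_id (eo_ob X)) _.
Next Obligation.
move=> X g; rewrite mcomp1f fun_id mcompf1.
have w : ((rep (coset H g))^-1 * g)%g \in H by exact: same_rep.
by apply: etrans (glue_rE (comparison_ob X) erefl w) _; exact: eo_r_swap.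
Qed.

Program Definition restrict_glue_iso (Y : equivariantization sigma) :
    @iso CH (restrict_ob H (glue_ob Y)) (eo_ob Y) :=
  @eqv_iso _ k C (restrict_action rho H) (restrict_ob H (glue_ob Y)) (eo_ob Y)
    (iso_id (eo_ob (eo_ob Y))) _.
Next Obligation.
move=> Y h; rewrite mcomp1f fun_id mcompf1.
by apply: etrans (glue_r_sub Y (subgP h)) _; rewrite eo_r_sub.
Qed.

Program Definition comparison_glue_iso (Y : equivariantization sigma) :
    @iso (equivariantization sigma) (comparison_ob (glue_ob Y)) Y :=
  @eqv_iso _ k CH sigma (comparison_ob (glue_ob Y)) Y (restrict_glue_iso Y) _.
Next Obligation.
move=> Y q; apply: eqv_hom_inj.
apply: etrans (mcomp1f _) _; apply: etrans (glue_r_rep Y q) _.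
by rewrite [RHS]/= fun_id mcompf1.
Qed.

Lemma comparison_equivalence : is_equivalence comparison.
Proof.
exists glue; split.
- apply: (@iso_family_natural CG CG (functor_comp glue comparison) (functor_id CG)
    glue_comparison_iso) => X Y f.
  by apply: eqv_hom_inj; rewrite /= mcomp1f mcompf1.
- apply: (@iso_family_natural _ _ (functor_comp comparison glue)
    (functor_id (equivariantization sigma)) comparison_glue_iso) => X Y f.
  by do 2!apply: eqv_hom_inj; rewrite /= mcomp1f mcompf1.
Qed.

End Comparison.

(** * Linear algebra in a fusion category *)

Section LinearCategory.
Variables (k : fieldType) (C : lin_category k).

Lemma mcompDl (X Y Z : C) (g g' : Hom Y Z) (f : Hom X Y) : (g + g') ∘ f = g ∘ f + g' ∘ f.
Proof. by have := mcomp_linl 1 g g' f; rewrite !scale1r. Qed.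

Lemma mcompDr (X Y Z : C) (g : Hom Y Z) (f f' : Hom X Y) : g ∘ (f + f') = g ∘ f + g ∘ f'.
Proof. by have := mcomp_linr 1 g f f'; rewrite !scale1r. Qed.

Lemma mcompZl (X Y Z : C) (a : k) (g : Hom Y Z) (f : Hom X Y) : (a *: g) ∘ f = a *: (g ∘ f).
Proof. by have := mcomp_linl a g 0 f; rewrite mcomp0l !addr0. Qed.

Lemma mcompZr (X Y Z : C) (a : k) (g : Hom Y Z) (f : Hom X Y) : g ∘ (a *: f) = a *: (g ∘ f).
Proof. by have := mcomp_linr a g f 0; rewrite mcomp0r !addr0. Qed.

Lemma mcompBl (X Y Z : C) (g g' : Hom Y Z) (f : Hom X Y) : (g - g') ∘ f = g ∘ f - g' ∘ f.
Proof. by rewrite mcompDl -scaleN1r mcompZl scaleN1r. Qed.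

Lemma mcompBr (X Y Z : C) (g : Hom Y Z) (f f' : Hom X Y) : g ∘ (f - f') = g ∘ f - g ∘ f'.
Proof. by rewrite mcompDr -scaleN1r mcompZr scaleN1r. Qed.

Lemma mcomp_suml (I : Type) (r : seq I) (P : pred I) (X Y Z : C) (g : I -> Hom Y Z)
    (f : Hom X Y) : (\sum_(i <- r | P i) g i) ∘ f = \sum_(i <- r | P i) (g i ∘ f).
Proof.
by apply: (big_morph (fun g => g ∘ f)) => [u v|]; rewrite ?mcompDl ?mcomp0l.
Qed.

Lemma mcomp_sumr (I : Type) (r : seq I) (P : pred I) (X Y Z : C) (g : Hom Y Z)
    (f : I -> Hom X Y) : g ∘ (\sum_(i <- r | P i) f i) = \sum_(i <- r | P i) (g ∘ f i).
Proof.
by apply: (big_morph (fun f => g ∘ f)) => [u v|]; rewrite ?mcompDr ?mcomp0r.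
Qed.

Lemma schur (S T : C) (f : Hom S T) : is_abelian C -> is_simple S -> is_simple T ->
  f != 0 -> is_isomorphism f.
Proof.
move=> ab [S0 simS] [T0 simT] fn0.
have [K [i [fi iU]]] := abelian_ker ab f.
have i_mono : is_mono i.
  move=> W u v uv; have [|h [_ hU]] := iU W (i ∘ u).
    by rewrite mcompA fi mcomp0l.
  by rewrite -(hU u) // -(hU v).
have K0 : is_zero K.
  case: (simS _ _ i_mono) => // -[j jE].
  case/eqP: fn0; apply: (iso_cancel_r (i := j)).
  by rewrite jE fi mcomp0l.
have f_mono : is_mono f.
  move=> W u v uv; have [|h [hE _]] := iU W (u - v).
    by rewrite mcompBr uv subrr.
  by apply/eqP; rewrite -subr_eq0 -hE -(mcompf1 i) K0 mcomp0r mcomp0l.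
by case: (simT _ _ f_mono).
Qed.

Lemma direct_sum_detect_l (I : finType) (S : I -> C) (X Y : C) (inc : forall i, Hom (S i) X)
    (pr : forall i, Hom X (S i)) (f : Hom Y X) :
  \sum_i (inc i ∘ pr i) = mid X -> f != 0 -> exists i, pr i ∘ f != 0.
Proof.
move=> e fn0; have [//|n] := pselect (exists i, pr i ∘ f != 0).
case/eqP: fn0; rewrite -(mcomp1f f) -e mcomp_suml big1 // => i _.
rewrite -mcompA; have [->|ni] := eqVneq (pr i ∘ f) 0; first exact: mcomp0r.
by case: n; exists i.
Qed.

Lemma direct_sum_detect_r (I : finType) (S : I -> C) (X Y : C) (inc : forall i, Hom (S i) X)
    (pr : forall i, Hom X (S i)) (f : Hom X Y) :
  \sum_i (inc i ∘ pr i) = mid X -> f != 0 -> exists i, f ∘ inc i != 0.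
Proof.
move=> e fn0; have [//|n] := pselect (exists i, f ∘ inc i != 0).
case/eqP: fn0; rewrite -(mcompf1 f) -e mcomp_sumr big1 // => i _.
rewrite mcompA; have [->|ni] := eqVneq (f ∘ inc i) 0; first exact: mcomp0l.
by case: n; exists i.
Qed.

End LinearCategory.

Section TensorFunctorLinear.
Variables (k : fieldType) (C D : lin_moncat k) (F : tensor_functor C D).

Lemma tfD (X Y : C) (f g : Hom X Y) : fun_hom F (f + g) = fun_hom F f + fun_hom F g.
Proof. by have := tf_lin F 1 f g; rewrite !scale1r. Qed.

Lemma tfZ (X Y : C) (a : k) (f : Hom X Y) : fun_hom F (a *: f) = a *: fun_hom F f.
Proof. by have := tf_lin F a f 0; rewrite tf0 !addr0. Qed.

Lemma tf_sum (I : Type) (r : seq I) (P : pred I) (X Y : C) (f : I -> Hom X Y) :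
  fun_hom F (\sum_(i <- r | P i) f i) = \sum_(i <- r | P i) fun_hom F (f i).
Proof. by apply: (big_morph (fun_hom F)) => [u v|]; [exact: tfD | exact: tf0]. Qed.

End TensorFunctorLinear.

Section FusionUnit.
Variables (k : fieldType) (C : lin_moncat k).
Hypothesis fC : is_fusion C.

Lemma unit_mid_neq0 : mid (munit : C) != 0.
Proof. by apply/eqP; case: (fusion_unit fC). Qed.

(** Some projection of X to a simple summand does not kill [b]; by Schur's lemma the composite is
    invertible, and its inverse gives the retraction. *)
Lemma unit_split_mono (X : C) (b : Hom munit X) :
  b != 0 -> exists s : Hom X munit, s ∘ b = mid munit.
Proof.
move=> bn0; have [ab ss] := fusion_semisimple fC.
have [n [S [simS [inc [pr [_ _ e]]]]]] := ss X.
have [i /(schur ab (fusion_unit fC) (simS i)) [j jE]] := direct_sum_detect_l e bn0.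
by exists (iso_inv j ∘ pr i); rewrite -mcompA -jE iso_homK.
Qed.

(** A nonzero map into a multiple of 1 is nonzero on a simple summand of Y, and Schur's lemma
    identifies that summand with 1. *)
Lemma unit_detect (X Y : C) (n : nat) (inc : 'I_n -> Hom munit X) (pr : 'I_n -> Hom X munit)
    (f : Hom Y X) : \sum_i (inc i ∘ pr i) = mid X -> f != 0 ->
  exists u : Hom munit Y, f ∘ u != 0.
Proof.
move=> e fn0; have [ab ss] := fusion_semisimple fC.
have [m [S [simS [inc' [pr' [_ _ e']]]]]] := ss Y.
have [i fi] := direct_sum_detect_r e' fn0.
have [j /(schur ab (simS i) (fusion_unit fC)) [l lE]] := direct_sum_detect_l e fi.
exists (inc' i ∘ iso_inv l); apply/eqP => f0.
have := unit_mid_neq0; rewrite -(iso_invK l) lE -!mcompA f0.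
by rewrite mcomp0r eqxx.
Qed.

Definition unit_scal (f : Hom (munit : C) munit) : k :=
  projT1 (cid (fusion_end fC (fusion_unit fC) f)).

Lemma unit_scalE (f : Hom (munit : C) munit) : f = unit_scal f *: mid munit.
Proof. exact: (projT2 (cid (fusion_end fC (fusion_unit fC) f))). Qed.

Lemma unit_scal_mid (a : k) : unit_scal (a *: mid munit) = a.
Proof.
apply/eqP; rewrite -subr_eq0.
have : (unit_scal (a *: mid munit) - a) *: mid (munit : C) == 0.
  by rewrite scalerBl -unit_scalE subrr.
by rewrite scaler_eq0 (negPf unit_mid_neq0) orbF.
Qed.

Lemma unit_scal_sum (I : finType) (f : I -> Hom (munit : C) munit) :
  unit_scal (\sum_i f i) = \sum_i unit_scal (f i).
Proof.
rewrite -[RHS]unit_scal_mid scaler_suml; congr unit_scal.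
by apply: eq_bigr => i _; exact: unit_scalE.
Qed.

Lemma unit_scalZ (a : k) (f : Hom (munit : C) munit) : unit_scal (a *: f) = a * unit_scal f.
Proof. by rewrite -[RHS]unit_scal_mid -scalerA -unit_scalE. Qed.

End FusionUnit.

(** * The G-module Hom(1, X) and subobjects stable under G *)

Section Invariants.
Variables (gT : finGroupType) (k : fieldType) (C : lin_moncat k).
Variables (rho : tensor_action gT C) (X : eqv_object rho).
Local Notation act := (act_functor rho).

Definition gact (g : gT) (v : Hom munit (eo_ob X)) : Hom munit (eo_ob X) :=
  eo_r X g ∘ (fun_hom (act g) v ∘ mf_eps (act g)).

Lemma gact_mul (g h : gT) (v : Hom munit (eo_ob X)) : gact g (gact h v) = gact (g * h) v.
Proof.
rewrite /gact !fun_comp -!mcompA (reassoc (eo_r_mul X (erefl (g * h)%g))).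
by rewrite (reassoc (act_mul_nat rho (erefl (g * h)%g) v)) act_mul_unit.
Qed.

Lemma gactZ (g : gT) (a : k) (v : Hom munit (eo_ob X)) : gact g (a *: v) = a *: gact g v.
Proof. by rewrite /gact tfZ mcompZl mcompZr. Qed.

Lemma gactD (g : gT) (v w : Hom munit (eo_ob X)) : gact g (v + w) = gact g v + gact g w.
Proof. by rewrite /gact tfD mcompDl mcompDr. Qed.

Lemma gact_sum (g : gT) (I : Type) (r : seq I) (P : pred I) (v : I -> Hom munit (eo_ob X)) :
  gact g (\sum_(i <- r | P i) v i) = \sum_(i <- r | P i) gact g (v i).
Proof. by rewrite /gact tf_sum mcomp_suml mcomp_sumr. Qed.

Lemma gact_r (g : gT) (v : Hom munit (eo_ob X)) :
  eo_r X g ∘ fun_hom (act g) v = gact g v ∘ iso_inv (mf_eps (act g)).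
Proof. by rewrite /gact -!mcompA iso_invK mcompf1. Qed.

Lemma invariant_equivariant (v : Hom munit (eo_ob X)) :
  (forall g, gact g v = v) <-> @is_equivariant gT k C rho (eqv_unit rho) X v.
Proof.
split=> [inv|/forallP ev g].
  by apply/forallP => g; rewrite gact_r inv.
by rewrite /gact mcompA -(eqP (ev g)) -mcompA iso_homK mcompf1.
Qed.

End Invariants.

Lemma gact_equivariant (gT : finGroupType) (k : fieldType) (C : lin_moncat k)
    (rho : tensor_action gT C) (X Y : eqv_object rho) (f : eqv_hom X Y) (g : gT)
    (v : Hom munit (eo_ob X)) : eh_hom f ∘ gact g v = gact g (eh_hom f ∘ v).
Proof. by rewrite /gact fun_comp !mcompA eqv_homP. Qed.

Section SubObject.
Variables (gT : finGroupType) (k : fieldType) (C : lin_moncat k).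
Variables (rho : tensor_action gT C) (X : eqv_object rho) (Z : C).
Local Notation act := (act_functor rho).
Variables (f : Hom Z (eo_ob X)) (s : Hom (eo_ob X) Z).
Hypothesis sf : s ∘ f = mid Z.
Hypothesis stable : forall g, f ∘ (s ∘ (eo_r X g ∘ fun_hom (act g) f)) =
  eo_r X g ∘ fun_hom (act g) f.

(** The structure map of X on Z, corestricted by [s]. The condition [stable] says that the image
    already lies in Z, so composing with f loses nothing. *)
Definition sub_object_r (g : gT) : Hom (act g Z) Z := s ∘ (eo_r X g ∘ fun_hom (act g) f).

Lemma sub_object_rE (g : gT) : f ∘ sub_object_r g = eo_r X g ∘ fun_hom (act g) f.
Proof. exact: stable. Qed.

Lemma sub_object_mul (g h : gT) : sub_object_r g ∘ fun_hom (act g) (sub_object_r h) =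
  sub_object_r (g * h)%g ∘ act_mu rho g h Z.
Proof.
rewrite {1 3}/sub_object_r -!mcompA -fun_comp sub_object_rE fun_comp.
rewrite (reassoc (eo_r_mul X (erefl (g * h)%g))) -act_mul_erefl.
by rewrite act_mul_nat.
Qed.

Lemma sub_object_one : sub_object_r 1%g ∘ act_one rho Z = mid Z.
Proof.
rewrite /sub_object_r -!mcompA -act_one_nat (mcompA (eo_r X 1%g)) act_oneE eo_unit.
by rewrite mcomp1f sf.
Qed.

Definition sub_object : eqv_object rho := family_object sub_object_mul sub_object_one.

Lemma sub_object_equivariant : @is_equivariant gT k C rho sub_object X f.
Proof. by apply/forallP => g; apply/eqP; exact: sub_object_rE. Qed.

Definition sub_object_hom : eqv_hom sub_object X := EqHom sub_object_equivariant.

End SubObject.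

(** * Normal subgroups give normal functors *)

Section DualFamily.
Variables (k : fieldType) (C : lin_moncat k).
Hypothesis fC : is_fusion C.
Variables (X : C) (V : Hom munit X -> Prop).
Hypothesis V_lin : forall (a : k) v w, V v -> V w -> V (a *: v + w).

(** Vectors of V with a biorthogonal family of maps to 1. The [s] play the role of a dual basis and
    make the span of [b] a retract of X isomorphic to 1^n. *)
Definition dual_family (n : nat) (b : 'I_n -> Hom munit X) (s : 'I_n -> Hom X munit) : Prop :=
  (forall i, V (b i)) /\ forall i j, s i ∘ b j = (i == j)%:R *: mid munit.

(** Expanding each [b j] in a finite spanning family of Hom(1, X) factors the identity matrix of
    size n through k^N. *)
Lemma dual_family_bound :
  exists N, forall n (b : 'I_n -> Hom munit X) s, dual_family b s -> (n <= N)%N.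
Proof.
have [N [e eP]] := fusion_hom_finite fC munit X; exists N => n b s [_ sb].
pose c (j : 'I_n) := projT1 (cid (eP (b j))).
have cE j : b j = \sum_l c j l *: e l := projT2 (cid (eP (b j))).
pose A : 'M[k]_(n, N) := \matrix_(j, l) c j l.
pose B : 'M[k]_(N, n) := \matrix_(l, i) unit_scal fC (s i ∘ e l).
apply: (@mulmx1_min _ _ _ A B).
apply/matrixP => j i; rewrite !mxE.
have <- : unit_scal fC (s i ∘ b j) = (j == i)%:R.
  by rewrite sb unit_scal_mid eq_sym.
rewrite cE mcomp_sumr unit_scal_sum; apply: eq_bigr => l _.
by rewrite !mxE mcompZr unit_scalZ.
Qed.

Definition residue (n : nat) (b : 'I_n -> Hom munit X) (s : 'I_n -> Hom X munit)
  (v : Hom munit X) : Hom munit X := v - \sum_i (b i ∘ (s i ∘ v)).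

Lemma V_sum (n : nat) (b : 'I_n -> Hom munit X) (c : 'I_n -> k) (v : Hom munit X) :
  (forall i, V (b i)) -> V v -> V (v - \sum_i c i *: b i).
Proof.
move=> Vb; elim: (index_enum _) v => [|i r IH] v Vv; first by rewrite big_nil subr0.
rewrite big_cons opprD addrA; apply: IH.
by rewrite addrC -scaleNr; exact: V_lin.
Qed.

Lemma residueV (n : nat) (b : 'I_n -> Hom munit X) s v :
  dual_family b s -> V v -> V (residue b s v).
Proof.
move=> [Vb _] Vv; rewrite /residue.
under eq_bigr => i _ do rewrite [s i ∘ v](unit_scalE fC) mcompZr mcompf1.
exact: V_sum.
Qed.

Lemma dual_residue (n : nat) (b : 'I_n -> Hom munit X) s v i :
  dual_family b s -> s i ∘ residue b s v = 0.
Proof.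
move=> [_ sb]; rewrite /residue mcompBr mcomp_sumr (bigD1 i) //= mcompA sb eqxx.
rewrite scale1r mcomp1f big1 ?addr0 ?subrr // => j ji.
by rewrite mcompA sb eq_sym (negPf ji) scale0r mcomp0l.
Qed.

Lemma dual_family_extend (n : nat) (b : 'I_n -> Hom munit X) s v :
  dual_family b s -> V v -> residue b s v != 0 ->
  exists b' s', @dual_family n.+1 b' s'.
Proof.
move=> d Vv r0; have [t tr] := unit_split_mono fC r0; have [Vb sb] := d.
(* [t] retracts the residue but may be nonzero on the old vectors; subtracting its values on them
   restores biorthogonality, and keeps its value on the residue because each [s i] kills it. *)
pose t' := t - \sum_i ((t ∘ b i) ∘ s i).
have t'b i : t' ∘ b i = 0.
  rewrite /t' mcompBl mcomp_suml (bigD1 i) //= -mcompA sb eqxx scale1r mcompf1.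
  rewrite big1 ?addr0 ?subrr // => j ji.
  by rewrite -mcompA sb (negPf ji) scale0r mcomp0r.
have t'r : t' ∘ residue b s v = mid munit.
  rewrite /t' mcompBl tr mcomp_suml big1 ?subr0 // => i _.
  by rewrite -mcompA dual_residue // mcomp0r.
exists (fun i => oapp b (residue b s v) (unlift ord0 i)).
exists (fun i => oapp s t' (unlift ord0 i)); split=> [i|i j].
  by case: unliftP => [j _|_] /=; [exact: Vb | exact: residueV].
case: (unliftP ord0 i) => [i' ->|->]; case: (unliftP ord0 j) => [j' ->|->] /=.
- by rewrite sb (inj_eq lift_inj).
- by rewrite dual_residue // scale0r.
- by rewrite t'b scale0r.
- by rewrite t'r scale1r.
Qed.

Lemma dual_family_complete : exists n (b : 'I_n -> Hom munit X) s,
  dual_family b s /\ forall v, V v -> \sum_i (b i ∘ (s i ∘ v)) = v.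
Proof.
have [N NP] := dual_family_bound.
(* [m] counts the extensions that the bound [N] still allows; at m = 0 a further extension would
   have more than [N] members. *)
suff H m n b s : (N <= n + m)%N -> @dual_family n b s -> exists n (b : 'I_n -> Hom munit X) s,
    dual_family b s /\ forall v, V v -> \sum_i (b i ∘ (s i ∘ v)) = v.
  by apply: (H N 0 (fun _ => 0) (fun _ => 0)) => //; split=> [[]|[]].
elim: m n b s => [|m IH] n b s nm d.
all: have [c|nc] := pselect (forall v, V v -> \sum_i (b i ∘ (s i ∘ v)) = v);
  first by exists n, b, s.
all: have [v [Vv rv]] : exists v, V v /\ residue b s v != 0 by
  apply: contrapT => nv; apply: nc => v Vv; apply: contrapT => /eqP cv;
  apply: nv; exists v; split=> //; rewrite subr_eq0 eq_sym.
all: have [b' [s' d']] := dual_family_extend d Vv rv.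
- by have := NP _ _ _ d'; rewrite addn0 in nm; rewrite ltnNge nm.
- by apply: IH d'; rewrite addSnnS.
Qed.

End DualFamily.

Section UnitMultiple.
Variables (gT : finGroupType) (k : fieldType) (C : lin_moncat k).
Variables (rho : tensor_action gT C).
Local Notation act := (act_functor rho).
Local Notation CG := (equivariantization rho).

(** Equivariance of the [s i] is forced: they are the coordinates relative to the invariant family
    [b], as one sees by inserting the identity of X, written as the sum of the b_j s_j, under
    rho(g). *)
Lemma unit_multiple (X : CG) (n : nat) (b : 'I_n -> Hom munit (eo_ob X)) s :
  (forall i g, gact g (b i) = b i) ->
  (forall i j, s i ∘ b j = (i == j)%:R *: mid munit) ->
  \sum_i (b i ∘ s i) = mid (eo_ob X) ->
  is_direct_sum (fun _ : 'I_n => munit : CG) X.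
Proof.
move=> binv sb bs.
have eb i := proj1 (invariant_equivariant (b i)) (binv i).
have es i : @is_equivariant gT k C rho X (eqv_unit rho) (s i).
  apply/forallP => g; apply/eqP.
  rewrite -[X in s i ∘ X]mcompf1 -(fun_id (act g)) -bs tf_sum !mcomp_sumr.
  rewrite (bigD1 i) //= big1 ?addr0 => [|j ji].
    rewrite fun_comp (mcompA (eo_r X g)) gact_r binv !mcompA sb eqxx scale1r.
    by rewrite mcomp1f.
  by rewrite fun_comp (mcompA (eo_r X g)) gact_r binv !mcompA sb eq_sym (negPf ji)
    scale0r !mcomp0l.
exists (fun i => EqHom (eb i)), (fun i => EqHom (es i)); split.
- by move=> i; apply: eqv_hom_inj; rewrite /= sb eqxx scale1r.
- by move=> i j ij; apply: eqv_hom_inj; rewrite /= sb eq_sym (negPf ij) scale0r.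
- apply: eqv_hom_inj; rewrite [RHS]/= -bs.
  exact: (big_morph (@eh_hom _ _ _ _ _ _)).
Qed.

End UnitMultiple.

Lemma split_mono_eqv (gT : finGroupType) (k : fieldType) (C : lin_moncat k)
    (rho : tensor_action gT C) (X Y : equivariantization rho) (f : Hom X Y)
    (s : Hom (eo_ob Y) (eo_ob X)) : s ∘ eh_hom f = mid _ -> is_mono f.
Proof.
move=> sf W u v /(congr1 (fun h : eqv_hom _ _ => s ∘ eh_hom h)) /=.
by rewrite !mcompA sf !mcomp1f => uv; exact: eqv_hom_inj.
Qed.

Section NormalRestriction.
Variables (gT : finGroupType) (k : fieldType) (C : lin_moncat k).
Hypothesis fC : is_fusion C.
Variables (rho : tensor_action gT C) (H : {group gT}).
Local Notation act := (act_functor rho).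
Local Notation CG := (equivariantization rho).

Lemma restriction_normal : (H <| [set: gT])%g -> is_normal_functor (restriction_functor rho H).
Proof.
move=> nH X simX [W [inc [pr [pi1 _ _]]]].
pose b0 : Hom munit (eo_ob X) := eh_hom (inc true).
pose V v := forall h, h \in H -> @gact gT k C rho X h v = v.
have V_lin a v w : V v -> V w -> V (a *: v + w).
  by move=> Vv Vw h hH; rewrite gactD gactZ Vv // Vw.
have V_gact g v : V v -> V (gact g v).
  move=> Vv h hH; rewrite gact_mul.
  have -> : (h * g = g * h ^ g)%g by rewrite conjgE mulKVg.
  by rewrite -gact_mul Vv // memJ_norm // (norm_setT nH).
have Vb0 : V b0.
  move=> h hH; have := proj2 (invariant_equivariant (X := restrict_ob H X) b0).
  by move=> /(_ (eh_equivariant (inc true)) (Subg hH)).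
have b0n0 : b0 != 0.
  apply/eqP => b0E; have := unit_mid_neq0 fC.
  have <- : eh_hom (pr true) ∘ b0 = mid munit :=
    congr1 (fun f : eqv_hom _ _ => eh_hom f) (pi1 true).
  by rewrite b0E mcomp0r eqxx.
have [n [b [s [[Vb sb] bs]]]] := dual_family_complete fC V_lin.
have [Z [iZ [pZ [pi iZ0 sZ]]]] := abelian_sums (proj1 (fusion_semisimple fC))
  (fun _ : 'I_n => munit : C).
(* [f] maps Z = 1^n onto the span of the H-invariants and [t] is a retraction, so that [f ∘ t] fixes
   every vector of V. *)
pose f := \sum_i (b i ∘ pZ i); pose t := \sum_i (iZ i ∘ s i).
have pf i : f ∘ iZ i = b i.
  rewrite /f mcomp_suml (bigD1 i) //= -mcompA pi mcompf1 big1 ?addr0 // => j ji.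
  by rewrite -mcompA iZ0 1?eq_sym // mcomp0r.
have tb i : t ∘ b i = iZ i.
  rewrite /t mcomp_suml (bigD1 i) //= -mcompA sb eqxx scale1r mcompf1.
  rewrite big1 ?addr0 // => j ji.
  by rewrite -mcompA sb (negPf ji) scale0r mcomp0r.
have tf : t ∘ f = mid Z.
  by rewrite /f mcomp_sumr -sZ; apply: eq_bigr => i _; rewrite mcompA tb.
have ft : f ∘ t = \sum_i (b i ∘ s i).
  by rewrite /t mcomp_sumr; apply: eq_bigr => i _; rewrite mcompA pf.
have fV v : V v -> f ∘ (t ∘ v) = v.
  move=> Vv; rewrite mcompA ft mcomp_suml -[RHS]bs //.
  by apply: eq_bigr => i _; rewrite mcompA.
have stable g : f ∘ (t ∘ (eo_r X g ∘ fun_hom (act g) f)) = eo_r X g ∘ fun_hom (act g) f.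
  rewrite {2 3}/f tf_sum !mcomp_sumr; apply: eq_bigr => i _.
  rewrite fun_comp (mcompA (eo_r X g)) gact_r.
  move: (gact g (b i)) (V_gact g _ (Vb i)) => w Vw.
  by rewrite -!mcompA (mcompA t) (mcompA f) fV.
pose j : @Hom CG (sub_object tf stable) X := sub_object_hom tf stable.
have j_mono : is_mono j := @split_mono_eqv _ _ _ _ _ _ j t tf.
(* A zero subobject would make [b0], which factors through [f], vanish. Otherwise [f] is invertible,
   so [f ∘ t] is the identity and the [b i] and [s i] decompose X. *)
case: (proj2 simX _ _ j_mono) => [z|[i iE]].
  case/eqP: b0n0; rewrite -(fV _ Vb0) -[f]mcompf1.
  have -> : mid Z = 0 := congr1 (fun f : eqv_hom _ _ => eh_hom f) z.
  by rewrite mcomp0r mcomp0l.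
exists n; apply: (@unit_multiple _ k C (restrict_action rho H) (restrict_ob H X) n b s) => //.
  by move=> l h; exact: (Vb l (sgval h) (subgP h)).
have fi : f ∘ eh_hom (iso_inv i) = mid (eo_ob X).
  by have := congr1 (fun f : eqv_hom _ _ => eh_hom f) (iso_invK i); rewrite iE.
by rewrite -ft -[LHS]mcompf1 -fi -mcompA (mcompA t) tf mcomp1f.
Qed.

End NormalRestriction.

(** * Normal functors come from normal subgroups *)

Section EquivariantSplitting.
Variables (gT : finGroupType) (k : fieldType) (C : lin_moncat k).
Hypothesis fC : is_fusion C.
Variables (rho : tensor_action gT C).
Local Notation act := (act_functor rho).
Local Notation CG := (equivariantization rho).

(** The complement is the kernel of [l] taken in C: it is stable under the structure maps because
    [l] is equivariant, and its projection is equivariant because [b] is too. *)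
Lemma unit_retract_summand (X : CG) (b : Hom munit X) (l : Hom X munit) :
  l ∘ b = mid munit ->
  exists W : CG, is_direct_sum (fun c : bool => if c then munit else W) X.
Proof.
move=> lb; pose l0 := eh_hom l; pose b0 := eh_hom b.
have lb0 : l0 ∘ b0 = mid munit := congr1 (fun f : eqv_hom _ _ => eh_hom f) lb.
have [K [f [lf fU]]] := abelian_ker (proj1 (fusion_semisimple fC)) l0.
have [|s [fs _]] := fU _ (mid _ - b0 ∘ l0).
  by rewrite mcompBr mcompA lb0 mcomp1f mcompf1 subrr.
have f_inj W (u v : Hom W K) : f ∘ u = f ∘ v -> u = v.
  move=> uv; have [|h [_ hU]] := fU W (f ∘ u); first by rewrite mcompA lf mcomp0l.
  by rewrite -(hU u) // -(hU v).
have sf : s ∘ f = mid K.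
  apply: f_inj; rewrite mcompA fs mcompBl -mcompA lf mcomp0r subr0.
  by rewrite mcomp1f mcompf1.
have sb : s ∘ b0 = 0.
  apply: f_inj; rewrite mcompA fs mcompBl -mcompA lb0 mcomp1f mcompf1 subrr.
  by rewrite mcomp0r.
have lr g : l0 ∘ eo_r X g = iso_inv (mf_eps (act g)) ∘ fun_hom (act g) l0 := eqv_homP l g.
have br g : b0 ∘ iso_inv (mf_eps (act g)) = eo_r X g ∘ fun_hom (act g) b0 := eqv_homP b g.
have stable g : f ∘ (s ∘ (eo_r X g ∘ fun_hom (act g) f)) = eo_r X g ∘ fun_hom (act g) f.
  rewrite mcompA fs mcompBl mcomp1f -mcompA (mcompA l0) lr -mcompA -fun_comp lf tf0.
  by rewrite !mcomp0r subr0.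
have es : @is_equivariant gT k C rho X (sub_object sf stable) s.
  apply/forallP => g; apply/eqP; rewrite [X in X ∘ _]/= /sub_object_r -!mcompA -fun_comp fs.
  rewrite -scaleN1r tfD tfZ scaleN1r mcompBr fun_id mcompf1 fun_comp.
  by rewrite mcompA -br mcompBr -mcompA (mcompA s) sb mcomp0l subr0.
pose W : CG := sub_object sf stable.
pose inc (c : bool) : Hom (if c then munit else W) X :=
  if c as c' return Hom (if c' then munit else W) X then b else sub_object_hom sf stable.
pose pr (c : bool) : Hom X (if c then munit else W) :=
  if c as c' return Hom X (if c' then munit else W) then l else EqHom es.
exists W, inc, pr; split.
- by case=> //=; apply: eqv_hom_inj; exact: sf.
- by case; case=> //= _; apply: eqv_hom_inj; [exact: sb | exact: lf].
- apply: eqv_hom_inj; rewrite big_bool.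
  have -> : eh_hom ((inc true ∘ pr true) + (inc false ∘ pr false)) =
    b0 ∘ l0 + f ∘ s by [].
  by rewrite fs addrC subrK.
Qed.

Lemma unit_multiple_trivial (X : CG) (n : nat) :
  is_direct_sum (fun _ : 'I_n => munit : CG) X ->
  forall (g : gT) (v : Hom munit (eo_ob X)), gact g v = v.
Proof.
move=> [inc [pr [_ _ e]]] g v.
have eE : \sum_i (eh_hom (inc i) ∘ eh_hom (pr i)) = mid (eo_ob X).
  apply: etrans _ (congr1 (fun f : eqv_hom _ _ => eh_hom f) e).
  by apply: esym; exact: (big_morph (@eh_hom _ _ _ _ _ _)).
rewrite -[v]mcomp1f -eE mcomp_suml gact_sum; apply: eq_bigr => i _.
rewrite -mcompA [eh_hom (pr i) ∘ v](unit_scalE fC) mcompZr mcompf1 gactZ.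
congr (_ *: _).
exact: (proj2 (invariant_equivariant (eh_hom (inc i))) (eh_equivariant (inc i)) g).
Qed.

(** Conjugation action of G on the morphisms of C from X to Y; its fixed points are the equivariant
    morphisms. *)
Definition conj_hom (X Y : CG) (g : gT) (t : Hom (eo_ob X) (eo_ob Y)) :
    Hom (eo_ob X) (eo_ob Y) := eo_r Y g ∘ (fun_hom (act g) t ∘ iso_inv (eo_r X g)).

Lemma conj_hom_r (X Y : CG) (g h : gT) (t : Hom (eo_ob X) (eo_ob Y)) :
  eo_r Y h ∘ fun_hom (act h) (conj_hom g t) = conj_hom (h * g)%g t ∘ eo_r X h.
Proof.
apply: (iso_cancel_r (i := fun_iso (act h) (eo_r X g))).
rewrite -[LHS]mcompA -[RHS]mcompA (eo_r_mul X (erefl (h * g)%g)) /= -fun_comp.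
rewrite /conj_hom -!mcompA iso_homK mcompf1 (mcompA (iso_inv _)) iso_homK mcomp1f.
by rewrite fun_comp (reassoc (eo_r_mul Y (erefl (h * g)%g))) act_mul_nat.
Qed.

(** Maschke's argument: since f is equivariant, every conjugate of the section [t] is again a
    section, and so is the average of all of them. *)
Lemma equivariant_splitting (X Y : CG) (f : Hom Y X) (t : Hom (eo_ob X) (eo_ob Y)) :
  #|gT|%:R != 0 :> k -> eh_hom f ∘ t = mid _ -> exists t' : Hom X Y, f ∘ t' = mid X.
Proof.
move=> n0 ft; pose u := #|gT|%:R^-1 *: \sum_g conj_hom (X := X) (Y := Y) g t.
have eu : @is_equivariant gT k C rho X Y u.
  apply/forallP => h; apply/eqP; rewrite /u tfZ mcompZl mcompZr; congr (_ *: _).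
  rewrite tf_sum mcomp_sumr mcomp_suml (reindex_inj (mulgI h)).
  by apply: eq_bigr => g _; rewrite conj_hom_r.
exists (EqHom eu); apply: eqv_hom_inj; rewrite /= mcompZr mcomp_sumr.
rewrite (eq_bigr (fun=> mid (eo_ob X))) => [|g _].
  by rewrite sumr_const -scaler_nat scalerA mulVf // scale1r.
rewrite /conj_hom (reassoc (eqv_homP f g)) (mcompA (fun_hom (act g) _)) -fun_comp ft.
by rewrite fun_id mcomp1f iso_invK.
Qed.

End EquivariantSplitting.

(** * The object of C^G attached to a matrix representation *)

Section RepObject.
Variables (gT : finGroupType) (k : fieldType) (C : lin_moncat k).
Hypothesis fC : is_fusion C.
Variables (rho : tensor_action gT C) (n : nat).
Variable rG : mx_representation k [set: gT] n.
Variables (Z : C) (inc : 'I_n -> Hom munit Z) (pr : 'I_n -> Hom Z munit).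
Hypothesis pr_inc : forall i, pr i ∘ inc i = mid munit.
Hypothesis pr_inc0 : forall i j, i != j -> pr j ∘ inc i = 0.
Hypothesis inc_pr : \sum_i (inc i ∘ pr i) = mid Z.
Local Notation act := (act_functor rho).
Local Notation CG := (equivariantization rho).

Definition elt (v : 'rV[k]_n) : Hom munit Z := \sum_i v 0 i *: inc i.

Lemma pr_elt (i : 'I_n) (v : 'rV[k]_n) : pr i ∘ elt v = v 0 i *: mid munit.
Proof.
rewrite mcomp_sumr (bigD1 i) //= mcompZr pr_inc big1 ?addr0 // => j ji.
by rewrite mcompZr pr_inc0 // scaler0.
Qed.

Definition coords (u : Hom munit Z) : 'rV[k]_n := \row_i unit_scal fC (pr i ∘ u).

Lemma coordsK (u : Hom munit Z) : elt (coords u) = u.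
Proof.
rewrite -[RHS]mcomp1f -inc_pr mcomp_suml; apply: eq_bigr => i _.
by rewrite -mcompA [pr i ∘ u](unit_scalE fC) mcompZr mcompf1 mxE.
Qed.

Lemma eltK (v : 'rV[k]_n) : coords (elt v) = v.
Proof. by apply/rowP => i; rewrite mxE pr_elt unit_scal_mid. Qed.

Lemma elt_lin (a : k) (v w : 'rV[k]_n) : elt (a *: v + w) = a *: elt v + elt w.
Proof.
rewrite /elt scaler_sumr -big_split; apply: eq_bigr => i _ /=.
by rewrite !mxE scalerDl scalerA.
Qed.

Lemma elt_mulmx (m : nat) (v : 'rV[k]_m) (A : 'M[k]_(m, n)) :
  elt (v *m A) = \sum_i v 0 i *: elt (row i A).
Proof.
rewrite mulmx_sum_row; apply: (big_rec2 (fun x y => elt x = y)) => [|i x y _ <-].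
  by rewrite /elt big1 // => i _; rewrite mxE scale0r.
exact: elt_lin.
Qed.

Lemma elt_delta (i : 'I_n) : elt (delta_mx 0 i) = inc i.
Proof.
rewrite /elt (bigD1 i) //= mxE !eqxx scale1r big1 ?addr0 // => j ji.
by rewrite mxE (negPf ji) scale0r.
Qed.

(** Matrices act on row vectors from the right, so the left action required by C^G uses the inverse
    of g. *)
Definition rep_r (g : gT) : Hom (act g Z) Z :=
  \sum_i (elt (row i (rG g^-1%g)) ∘ (iso_inv (mf_eps (act g)) ∘ fun_hom (act g) (pr i))).

Lemma rep_r_elt (g : gT) (v : 'rV[k]_n) :
  rep_r g ∘ fun_hom (act g) (elt v) = elt (v *m rG g^-1%g) ∘ iso_inv (mf_eps (act g)).
Proof.
rewrite mcomp_suml elt_mulmx mcomp_suml; apply: eq_bigr => i _.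
by rewrite -!mcompA -fun_comp pr_elt tfZ fun_id !mcompZr mcompf1 mcompZl.
Qed.

Lemma rep_r_mul (g h : gT) :
  rep_r g ∘ fun_hom (act g) (rep_r h) = rep_r (g * h)%g ∘ act_mu rho g h Z.
Proof.
rewrite -act_mul_erefl {2 3}/rep_r tf_sum mcomp_sumr mcomp_suml.
apply: eq_bigr => i _; rewrite !fun_comp (reassoc (rep_r_elt g _)) -row_mul.
rewrite -repr_mxM ?inE // -invMg -!mcompA -act_mul_nat; congr (_ ∘ _).
rewrite !mcompA; congr (_ ∘ _).
apply: (iso_cancel_l (i := mf_eps (act (g * h)%g))); rewrite !mcompA iso_invK mcomp1f.
rewrite -(act_mul_unit rho (erefl (g * h)%g)) -!mcompA (mcompA (mf_eps _)) iso_invK.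
by rewrite mcomp1f -fun_comp iso_invK fun_id mcompf1.
Qed.

Lemma rep_r_one : rep_r 1%g ∘ act_one rho Z = mid Z.
Proof.
rewrite mcomp_suml -inc_pr; apply: eq_bigr => i _.
rewrite -!mcompA -act_one_nat act_one_unit (mcompA (iso_inv _)) iso_homK mcomp1f.
by rewrite invg1 repr_mx1 row1 elt_delta.
Qed.

Definition rep_object : CG := family_object rep_r_mul rep_r_one.

Lemma gact_elt (g : gT) (v : 'rV[k]_n) :
  @gact gT k C rho rep_object g (elt v) = elt (v *m rG g^-1%g).
Proof. by rewrite /gact mcompA rep_r_elt -mcompA iso_homK mcompf1. Qed.

(** A subobject Y gives the submodule of k^n formed by the image of Hom(1, Y). If it is zero, f
    vanishes because Hom(1, -) detects maps into a multiple of 1; if it is everything, f has a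
    section in C, which averaging makes equivariant. *)
Lemma rep_object_simple : #|gT|%:R != 0 :> k -> mx_irreducible rG -> is_simple rep_object.
Proof.
move=> n0 [_ nz irr]; split=> [z|Y f f_mono].
  have z0 : mid Z = 0 := congr1 (fun f : eqv_hom _ _ => eh_hom f) z.
  case/negP: nz; apply/eqP/row_matrixP => i; rewrite row1 row0 -[LHS]eltK.
  by rewrite -(mcomp1f (elt _)) z0 mcomp0l; apply/rowP => j;
    rewrite mxE mcomp0r -(scale0r (mid munit)) unit_scal_mid mxE.
have [N [e eP]] := fusion_hom_finite fC munit (eo_ob Y).
pose M := \matrix_(l < N) coords (eh_hom f ∘ e l).
have Mf v : (v <= M)%MS <-> exists u, eh_hom f ∘ u = elt v.
  split=> [/submxP [c ->]|[u fu]].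
    exists (\sum_l c 0 l *: e l); rewrite elt_mulmx mcomp_sumr; apply: eq_bigr => l _.
    by rewrite mcompZr rowK coordsK.
  have [c cE] := eP u; apply/submxP; exists (\row_l c l).
  rewrite -[LHS]eltK -[RHS]eltK elt_mulmx -fu cE mcomp_sumr; congr coords.
  by apply: eq_bigr => l _; rewrite mcompZr mxE rowK coordsK.
(* [M] has as many rows as Hom(1, Y) has chosen generators; [<<M>>] is a square matrix with the same
   row space, as irreducibility quantifies over square matrices. *)
have modM : mxmodule rG <<M>>%MS.
  rewrite (eqmx_module _ (genmxE M)); apply/mxmoduleP => g _; apply/row_subP => l.
  rewrite row_mul; apply/Mf; exists (gact g^-1%g (e l)).
  rewrite gact_equivariant -[X in gact _ X]coordsK; apply: etrans (gact_elt _ _) _.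
  by rewrite invgK rowK.
have [M0|Mn0] := eqVneq <<M>>%MS 0; [left|right].
  have fu0 (u : Hom munit (eo_ob Y)) : eh_hom f ∘ u = 0.
    have : (coords (eh_hom f ∘ u) <= M)%MS by apply/Mf; exists u; rewrite coordsK.
    rewrite -(genmxE M) M0 submx0 => /eqP c0; rewrite -[LHS]coordsK c0.
    by rewrite /elt big1 // => i _; rewrite mxE scale0r.
  apply: f_mono; rewrite mcomp0r mcompf1; apply: eqv_hom_inj; apply/eqP/negPn/negP => fn0.
  have [u] := unit_detect fC inc_pr fn0.
  by rewrite fu0 eqxx.
have sub1 := irr _ modM (submx1 _) Mn0.
have lift i : exists u, eh_hom f ∘ u = inc i.
  rewrite -elt_delta; apply/Mf; rewrite -row1.
  by apply: submx_trans (row_sub i _) _; rewrite -(genmxE M).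
pose u i := projT1 (cid (lift i)).
have uP i : eh_hom f ∘ u i = inc i := projT2 (cid (lift i)).
have ft : eh_hom f ∘ (\sum_i (u i ∘ pr i)) = mid Z.
  by rewrite mcomp_sumr -inc_pr; apply: eq_bigr => i _; rewrite mcompA uP.
have [t tE] := equivariant_splitting (X := rep_object) n0 ft.
have tf : t ∘ f = mid Y by apply: f_mono; rewrite mcompA tE mcomp1f mcompf1.
by exists (Iso tf tE).
Qed.

End RepObject.

(** * The permutation module on the cosets of H *)

Section CosetModule.
Variables (gT : finGroupType) (k : fieldType) (H : {group gT}).
Local Notation G := [set: gT].
Local Notation aG := (regular_repr k G).
Local Notation idx := (gring_index G).

Lemma idxK (x : gT) : enum_val (idx x) = x.
Proof. by rewrite gring_indexK ?inE. Qed.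

(* The rows are the indicator functions of the right cosets of H, so that the
   row space is k[H\G] inside the regular module. *)
Definition coset_mx : 'M[k]_#|G| :=
  \matrix_(i, j) ((enum_val j * (enum_val i)^-1)%g \in H)%:R.

Lemma regularE (x : gT) (i j : 'I_#|G|) : aG x i j = (enum_val j == enum_val i * x)%g%:R.
Proof.
by rewrite !mxE eqxx /= -[j in LHS]gring_valK (inj_eq (can_inj idxK)).
Qed.

Lemma coset_mxJ (x : gT) (i : 'I_#|G|) :
  row i (coset_mx *m aG x) = row (idx (enum_val i * x)%g) coset_mx.
Proof.
apply/rowP => j; rewrite !mxE (bigD1 (idx (enum_val j * x^-1)%g)) //=.
rewrite big1 => [|l lj]; rewrite regularE ?idxK.
  by rewrite mulgKV eqxx mulr1 addr0 mxE !idxK invMg mulgA.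
rewrite (_ : _ == _ = false) ?mulr0 //; apply: contra_neqF lj => /eqP ->.
by rewrite mulgK gring_valK.
Qed.

Lemma coset_mx_module : mxmodule aG coset_mx.
Proof. by apply/mxmoduleP => x _; apply/row_subP => i; rewrite coset_mxJ row_sub. Qed.

(** The coefficient at the identity, which on functions constant on the cosets Hy is evaluation at
    the coset H. *)
Definition eval_one : 'cV[k]_#|G| := delta_mx (idx 1%g) 0.

Lemma mulmx_eval_one (m : nat) (A : 'M[k]_(m, #|G|)) (i : 'I_m) :
  (A *m eval_one) i 0 = A i (idx 1%g).
Proof.
rewrite mxE (bigD1 (idx 1%g)) //= mxE !eqxx mulr1 big1 ?addr0 // => j ji.
by rewrite mxE (negPf ji) mulr0.
Qed.

Lemma coset_mx_eval (h : gT) : h \in H -> coset_mx *m aG h *m eval_one = coset_mx *m eval_one.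
Proof.
move=> hH; apply/colP => i; rewrite !mulmx_eval_one.
have := congr1 (fun A : 'rV__ => A 0 (idx 1%g)) (coset_mxJ h i); rewrite !mxE => ->.
by rewrite !idxK !mul1g !groupV groupMr.
Qed.

(** Translates of [eval_one] read off all coefficients, so this functional cannot vanish on a
    nonzero submodule. *)
Lemma regular_eval (x : gT) (m : nat) (A : 'M[k]_(m, #|G|)) (i : 'I_m) :
  (A *m aG x *m eval_one) i 0 = A i (idx x^-1%g).
Proof.
rewrite mulmx_eval_one mxE (bigD1 (idx x^-1%g)) //= regularE !idxK mulVg eqxx mulr1.
rewrite big1 ?addr0 // => j ji; rewrite regularE idxK.
rewrite (_ : _ == _ = false) ?mulr0 //; apply: contra_neqF ji => /eqP e.
by apply: (can_inj gring_valK); rewrite idxK; apply: (mulIg x); rewrite mulVg -e.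
Qed.

Hypothesis n0 : #|gT|%:R != 0 :> k.

Lemma subgroup_card_neq0 : #|H|%:R != 0 :> k.
Proof.
have := cardSg (subsetT H); rewrite cardsT => /dvdnP [m mE].
by move: n0; rewrite mE natrM mulf_eq0 negb_or => /andP [].
Qed.

Lemma fixed_vector (n : nat) (rG : mx_representation k G n) (l : 'cV[k]_n) :
  l != 0 -> (forall h, h \in H -> rG h *m l = l) ->
  exists v : 'rV[k]_n, (forall h, h \in H -> v *m rG h = v) /\ v *m l = 1%:M.
Proof.
move=> l0 lH.
have [i li] : exists i, l i 0 != 0.
  apply/existsP; rewrite -negb_forall; apply: contra l0 => /forallP l0.
  by apply/eqP/colP => i; rewrite mxE (eqP (l0 i)).
(* [l] takes the value [l i 0] on each of the #|H| translates of the basis vector, by its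
   invariance; the factor normalizes their sum to value 1. *)
pose v : 'rV[k]_n := (l i 0 * #|H|%:R)^-1 *: \sum_(h in H) (delta_mx 0 i *m rG h).
exists v; split=> [h hH|].
  rewrite /v -scalemxAl mulmx_suml; congr (_ *: _).
  rewrite [RHS](reindex_inj (mulIg h)) /=.
  rewrite [RHS](eq_bigl (mem H)) => [|x]; last by rewrite /= groupMr.
  by apply: eq_bigr => x xH; rewrite repr_mxM ?inE // mulmxA.
rewrite /v -scalemxAl mulmx_suml (eq_bigr (fun=> (l i 0)%:M)) => [|h hH].
  rewrite sumr_const -scaler_nat scalerA scale_scalar_mx -mulrA.
  by rewrite [_%:R * _]mulrC mulVf // mulf_neq0 // subgroup_card_neq0.
by rewrite -mulmxA lH // -rowE; apply/matrixP => a b; rewrite !ord1 !mxE eqxx mulr1n.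
Qed.

Lemma normal_of_irreducible :
  (forall n (rG : mx_representation k G n) (v : 'rV[k]_n) (l : 'cV[k]_n),
     mx_irreducible rG -> (forall h, h \in H -> v *m rG h = v) ->
     (forall h, h \in H -> rG h *m l = l) -> v *m l = 1%:M ->
     forall h, h \in H -> rG h = 1%:M) ->
  (H <| G)%g.
Proof.
move=> triv.
have simple_triv U h : mxsimple aG U -> (U <= coset_mx)%MS -> h \in H -> U *m aG h = U.
  move=> simU UM hH; have modU : mxmodule aG U by case: simU.
  pose rU := submod_repr modU.
  have valE (B : 'M_(\rank U)) : B *m val_submod (U := U) 1%:M = val_submod B.
    by rewrite [RHS]val_submodE.
  (* The restriction of [eval_one] to U, in the coordinates of [submod_repr]. *)
  pose l := val_submod (U := U) 1%:M *m eval_one.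
  have lH x : x \in H -> rU x *m l = l.
    move=> xH; rewrite /l mulmxA valE -[rU x]mul1mx val_submodJ ?inE //.
    have /submxP [D ->] : (val_submod (U := U) 1%:M <= coset_mx)%MS.
      exact: submx_trans (val_submodP _) UM.
    by rewrite -!mulmxA; congr (_ *m _); rewrite !mulmxA coset_mx_eval.
  have l0 : l != 0.
    apply: contraPneq simU => l0 [_ /negP U0 _]; apply: U0; apply/eqP/matrixP => i j.
    have /submxP [D DE] : (U *m aG (enum_val j)^-1%g <= val_submod (U := U) 1%:M)%MS.
      by rewrite val_submod1; apply: (mxmoduleP modU); rewrite inE.
    have := regular_eval (enum_val j)^-1%g U i.
    by rewrite DE -mulmxA -/l l0 mulmx0 invgK gring_valK !mxE => <-.
  have [v [vH vl]] := fixed_vector l0 lH.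
  have irr : mx_irreducible rU by apply/submod_mx_irr.
  have rU1 : submod_mx modU h = 1%:M := triv _ rU v l irr vH lH vl h hH.
  have := val_submodJ modU (in_submod U U) (in_setT h).
  by rewrite rU1 mulmx1 in_submodK // => <-.
have MH h : h \in H -> coset_mx *m aG h = coset_mx.
  move=> hH.
  have pG : ([pchar k]^'.-group G)%g by rewrite /pgroup cardsT -natf_neq0_pchar.
  have red : mx_completely_reducible aG coset_mx.
    exact: mx_reducibleS coset_mx_module (submx1 _) (mx_Maschke_pchar _ pG).
  (* A decomposition into simple modules is available only under [classically], which suffices for a
     boolean goal; hence the passage to the boolean equality. *)
  apply/eqP; apply: (mx_reducible_semisimple coset_mx_module red).
  move=> [I U W simU defM _]; rewrite -subr_eq0 -[X in _ - X]mulmx1 -mulmxBr.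
  apply/eqP/sub_kermxP; rewrite -defM; apply/sumsmx_subP => i _.
  apply/sub_kermxP; rewrite mulmxBr mulmx1 simple_triv ?subrr //.
  by rewrite -defM (sumsmx_sup i).
apply/andP; split; first exact: subsetT.
apply/subsetP => x _; rewrite inE; apply/subsetP => _ /imsetP [h hH ->].
(* The diagonal entry at x^-1 tests membership of 1 in H before acting by h, and of the inverse of h
   ^ x afterwards. *)
have := congr1 (fun A : 'M__ => A (idx x^-1%g) (idx x^-1%g)) (MH _ hH).
have := congr1 (fun A : 'rV__ => A 0 (idx x^-1%g)) (coset_mxJ h (idx x^-1%g)).
rewrite !mxE => -> /eqP; rewrite !idxK !invgK mulVg group1 invMg invgK.
rewrite -[(x^-1 * _)%g]/(h^-1 ^ x)%g conjVg groupV.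
by case: ((h ^ x)%g \in H) => //; rewrite eq_sym oner_eq0.
Qed.

End CosetModule.

Section NormalImpliesNormal.
Variables (gT : finGroupType) (k : fieldType) (C : lin_moncat k).
Hypothesis fC : is_fusion C.
Variables (rho : tensor_action gT C) (H : {group gT}).
Hypothesis n0 : #|gT|%:R != 0 :> k.
Local Notation act := (act_functor rho).
Local Notation CH := (equivariantization (restrict_action rho H)).

(** [v] and [l] become morphisms 1 -> X -> 1 of C^H with composite the identity, which is the
    summand that the definition of a normal functor asks for. On a multiple of 1, H fixes all of
    Hom(1, X), that is, all row vectors. *)
Lemma irreducible_trivial (n : nat) (rG : mx_representation k [set: gT] n)
    (v : 'rV[k]_n) (l : 'cV[k]_n) :
  is_normal_functor (restriction_functor rho H) -> mx_irreducible rG ->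
  (forall h, h \in H -> v *m rG h = v) -> (forall h, h \in H -> rG h *m l = l) ->
  v *m l = 1%:M -> forall h, h \in H -> rG h = 1%:M.
Proof.
move=> normal irr vH lH vl h hH.
have [Z [inc [pr [pr_inc pr_inc0 inc_pr]]]] := abelian_sums (proj1 (fusion_semisimple fC))
  (fun _ : 'I_n => munit : C).
pose X := rep_object rho rG pr_inc pr_inc0 inc_pr.
pose XH : CH := restrict_ob H X.
have simX : is_simple X :=
  rep_object_simple fC rho pr_inc pr_inc0 inc_pr n0 irr.
have ev : @is_equivariant _ k C _ (eqv_unit (restrict_action rho H)) XH (elt inc v).
  apply/invariant_equivariant => x.
  apply: etrans (gact_elt rho rG pr_inc pr_inc0 inc_pr (sgval x) v) _.
  by rewrite vH // groupV subgP.
pose l0 : Hom Z munit := \sum_i l i 0 *: pr i.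
have l0_elt w : l0 ∘ elt inc w = (w *m l) 0 0 *: mid munit.
  rewrite mcomp_suml mxE scaler_suml; apply: eq_bigr => i _.
  by rewrite mcompZl (pr_elt pr_inc pr_inc0) scalerA mulrC.
have l0_r x : x \in H -> l0 ∘ rep_r rho rG inc pr x =
    iso_inv (mf_eps (act x)) ∘ fun_hom (act x) l0.
  move=> xH; rewrite tf_sum !mcomp_sumr; apply: eq_bigr => i _.
  by rewrite [LHS]mcompA l0_elt -row_mul lH ?groupV // mxE mcompZl mcomp1f tfZ mcompZr.
have el : @is_equivariant _ k C _ XH (eqv_unit (restrict_action rho H)) l0.
  by apply/forallP => x; apply/eqP; exact: l0_r (subgP x).
have lv : (EqHom el : Hom XH munit) ∘ (EqHom ev : Hom munit XH) = mid munit.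
  by apply: eqv_hom_inj; rewrite /= l0_elt vl mxE eqxx scale1r.
have [m dm] := normal X simX (unit_retract_summand fC lv).
(* The element of H is rewritten as the inverse of its inverse, since an element acts on Hom(1, X)
   through the matrix of its inverse. *)
apply/row_matrixP => i; rewrite row1 rowE -{1}(invgK h).
have hVH : h^-1%g \in H by rewrite groupV.
rewrite -[LHS](eltK fC pr_inc pr_inc0) -[RHS](eltK fC pr_inc pr_inc0).
congr (coords _ _ _); apply: etrans (esym (gact_elt rho rG pr_inc pr_inc0 inc_pr h^-1%g _)) _.
exact: (unit_multiple_trivial fC dm (Subg hVH)).
Qed.

Lemma restriction_normal_group :
  is_normal_functor (restriction_functor rho H) -> (H <| [set: gT])%g.
Proof.
move=> normal; apply: (normal_of_irreducible n0) => n rG v l irr vH lH vl.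
exact: irreducible_trivial normal irr vH lH vl.
Qed.

End NormalImpliesNormal.

Theorem corollary5p4 (k : closedFieldType) (C : lin_moncat k)
    (C_fusion : is_fusion C) (gT : finGroupType) (rho : tensor_action gT C)
    (char_k : forall p : nat, p \in [pchar k]%R -> ~~ (p %| #|gT|)%N)
    (H : {group gT}) :
  (is_normal_functor (restriction_functor rho H) <-> (H <| [set: gT])%g) /\
  ((H <| [set: gT])%g ->
   exists (sigma : tensor_action (coset_of H)
                     (equivariantization (restrict_action rho H)))
          (K : tensor_functor (equivariantization rho)
                 (equivariantization sigma)),
     is_equivalence K /\
     tensor_functor_comp (forgetful_functor sigma) K = restriction_functor rho H).
Proof.
have n0 : #|gT|%:R != 0 :> k.
  rewrite natf_neq0_pchar; apply/pnatP => [|p p_pr pG].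
    by apply/card_gt0P; exists 1%g.
  by apply: contraL pG; exact: char_k.
split=> [|nH].
  split; first by refine (restriction_normal_group C_fusion n0).
  by move=> nH; refine (restriction_normal C_fusion nH).
exists (sigma rho nH), (comparison rho nH); split.
- exact: comparison_equivalence.
- exact: forgetful_comparison.
Qed.
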